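(* Assume the standing setup in the context, and assume the random shift $\hat\sigma$ together with the potential $\varphi$ is fine. Then there exists a random conformal measure $\nu=(\nu_x)_{x\in X}\in\mathcal P_m(\Omega)$, i.e. there is a measurable function $X\ni x\mapsto\lambda_x\in(0,+\infty)$ such that $\mathcal L_x^*\nu_{\theta(x)}=\lambda_x\nu_x$ for $m$-a.e. $x\in X$. In addition, $\operatorname{ess\,sup}_{x\in X}|\log\lambda_x|<\infty$.
   Context: Standing setup. $(X,\mathcal F,m)$ is a complete probability space and $\theta:X\to X$ is an invertible measurable map preserving $m$. $E=\mathbb N=\{0,1,2,\dots\}$, and $X\ni x\mapsto A(x)=(A_{ij}(x))_{i,j\in E}$ is a measurable map into $\{0,1\}$-valued matrices. For $x\in X$ and $n\ge 0$, $E_x^n$ is the set of words $\omega_0\omega_1\cdots\omega_n\in E^{n+1}$ with $A_{\omega_i\omega_{i+1}}(\theta^i(x))=1$ for $0\le i\le n-1$; for $F\subset E$, $F_x^n$ is the set of words in $E_x^n$ all of whose letters lie in $F$; $E_x^\infty$ is the set of $\omega\in E^{\mathbb N}$ with $A_{\omega_i\omega_{i+1}}(\theta^i(x))=1$ for all $i\ge0$. For $\omega\in E_x^n$, $[\omega]_x=\{\tau\in E_x^\infty:\tau_0\cdots\tau_n=\omega\}$; for $F\subset E$, $[F]_x=\bigcup_{j\in F}[j]_x$, $[0,\dots,l]_x=[\{0,\dots,l\}]_x$, and complements $B^c$ are taken in $E_x^\infty$. $E^{\mathbb N}$ carries the metric $d(\omega,\tau)=e^{-\min\{n:\omega_n\neq\tau_n\}}$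 for $\omega\ne\tau$. $\sigma$ is the left shift, $\sigma_x=\sigma|_{E_x^\infty}:E_x^\infty\to E_{\theta(x)}^\infty$, $\sigma_x^n=\sigma_{\theta^{n-1}(x)}\circ\cdots\circ\sigma_x$. $\Omega=\bigcup_{x\in X}\{x\}\times E_x^\infty$ with the restriction of the product $\sigma$-algebra of $\mathcal F$ and the Borel sets of $E^{\mathbb N}$; $\hat\sigma:\Omega\to\Omega$, $\hat\sigma(x,\omega)=(\theta(x),\sigma_x(\omega))$; for $g:\Omega\to\mathbb R$, $g_x=g(x,\cdot)$ and $S_ng=\sum_{j=0}^{n-1}g\circ\hat\sigma^j$. $\hat\sigma$ is assumed topologically mixing: for all $a,b\in E$ there is $N$ such that for every $n\ge N$ and every $x\in X$ there is a word $\omega$ of length $n+1$ with $a\omega b\in E_x^{n+2}$. Finite range: for every $e\in E$ there is a finite $D_e\subset E$ with $\{j:A_{ej}(x)=1\}\subset D_e$ for $m$-a.e. $x$. Bounded access: for every $b\in E$ there is $b^*\in E$ such that for $m$-a.e. $x$ there is $a\le b^*$ with $A_{ab}(x)=1$. Fix $\alpha>0$. For $g:E_x^\infty\to\mathbb R$, $v_\alpha(g)=\sup\{|g(\tau)-g(\omega)|/d(\tau,\omega)^\alpha:\tau\ne\omega,\ \tau_0=\omega_0\}$; $\mathcal H_\alpha(E_x^\infty)$ is the space of bounded continuous $g$ with $v_\alpha(g)<\infty$, normed by $\|g\|_\alpha=\|g\|_\infty+v_\alpha(g)$. A summable potential is a measurable $\varphi:\Omega\to\mathbb R$ with each $\varphi_x$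 continuous, $V_\alpha(\varphi):=\operatorname{ess\,sup}_x v_\alpha(\varphi_x)<\infty$, such that for every $e\in E$ there are $0<c_e<C_e<\infty$ with $c_e\le e^{\varphi_x}\le C_e$ on $[e]_x$ for $m$-a.e. $x$, and $\lim_{l\to\infty}\operatorname{ess\,sup}_x\sup\mathcal L_x(1_{[0,\dots,l]_x^c})=0$. Here the transfer operator $\mathcal L_x$ maps bounded continuous $g$ on $E_x^\infty$ to functions on $E_{\theta(x)}^\infty$ by $\mathcal L_xg(\omega)=\sum_{e\in E:\,A_{e\omega_0}(x)=1}g(e\omega)e^{\varphi_x(e\omega)}$, and $\mathcal L_x^n=\mathcal L_{\theta^{n-1}(x)}\circ\cdots\circ\mathcal L_x$. Conditions: (A) for every $e\in E$ there is $M_e\in(0,\infty)$ with $M_e^{-1}\le\mathcal L_x1$ on $[e]_{\theta(x)}$ for $m$-a.e. $x$; (B) $\lim_{e\to\infty}\operatorname{ess\,sup}_x\sup_{[e]_{\theta(x)}}\mathcal L_x1=0$; (C) there are $0<\kappa<1/4$ and a finite $F\subset E$ with $\sup\mathcal L_x(1_{E_x^\infty\setminus[F]_x})\le\kappa\inf_{[F]_{\theta(x)}}\mathcal L_x1$ for $m$-a.e. $x$. The pair $(\hat\sigma,\varphi)$ is fine if $\varphi$ is summable and (A), (B), (C) hold. A random measure is a probability measure $\nu$ on $\Omega$ with marginal $m$ on $X$; its disintegrations $\nu_x$ are Borel probability measures on $E_x^\infty$. $\mathcal P_m(\Omega)$ denotes the set of random measures. $\mathcal L_x^*\nu_{\theta(x)}$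 is the measure $B\mapsto\int\mathcal L_x1_B\,d\nu_{\theta(x)}$ on $E_x^\infty$. A random conformal measure is $\nu\in\mathcal P_m(\Omega)$ for which there is measurable $\lambda:X\to(0,\infty)$ with $\mathcal L_x^*\nu_{\theta(x)}=\lambda_x\nu_x$ for $m$-a.e. $x$. *)

(* Defs.v *)
From HB Require Import structures.
From mathcomp Require Import all_boot all_order all_algebra.
From mathcomp Require Import all_classical all_reals all_analysis.
From mathcomp Require Import measurable_realfun ess_sup_inf.
Set Implicit Arguments. Unset Strict Implicit. Unset Printing Implicit Defensive.
Import Order.TTheory GRing.Theory Num.Theory.
Import numFieldNormedType.Exports.
Local Open Scope classical_set_scope.
Local Open Scope ring_scope.

Definition word := nat -> nat.

(* The Borel sigma-algebra of E^N (product topology of discrete nat) is the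
   sigma-algebra generated by the coordinate sets {w | w n = k}. *)
Definition coord_sets : set (set word) :=
  [set B | exists n k, B = [set w : word | w n = k]].

Definition Seq := g_sigma_algebraType coord_sets.

Definition scons (e : nat) (w : Seq) : Seq :=
  fun n => if n is n'.+1 then w n' else e.

Section Defs.
Context {d : measure_display} {T : measurableType d} {R : realType}.
Variables (theta : T -> T) (A : T -> nat -> nat -> bool).

Definition adm_word (x : T) (n : nat) (w : nat -> nat) : Prop :=
  forall i, (i < n)%N -> A (iter i theta x) (w i) (w i.+1).

Definition Einf (x : T) : set Seq :=
  [set w | forall i, A (iter i theta x) (w i) (w i.+1)].

Definition cylF (F : set nat) (x : T) : set Seq :=
  [set w | Einf x w /\ F (w 0%N)].

Definition Omega : set (T * Seq) := [set p | Einf p.1 p.2].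

Definition dist (w t : Seq) : R :=
  match pselect (exists n, w n != t n) with
  | left h => expR (- (@ex_minn (fun n => w n != t n) h)%:R)
  | right _ => 0
  end.

Definition v_alpha (alpha : R) (S : set Seq) (g : Seq -> R) : \bar R :=
  ereal_sup [set y | exists t w, [/\ S t, S w, t <> w, t 0%N = w 0%N &
     y = ((`|g t - g w| / (dist t w) `^ alpha)%:E)]].

Variable phi : T -> Seq -> R.

Definition Lop (x : T) (g : Seq -> \bar R) (w : Seq) : \bar R :=
  (\sum_(0 <= e <oo)
     (if A x e (w 0%N) then g (scons e w) * (expR (phi x (scons e w)))%:E
      else 0))%E.

Definition ind (B : set Seq) : Seq -> \bar R := fun w => (\1_B w)%:E.

Definition one : Seq -> \bar R := fun _ => 1%E.

Variable m : {measure set T -> \bar R}.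

(* phi_x continuous on E_x^infty (w.r.t. the metric d, whose balls are cylinders) *)
Definition phi_continuous : Prop :=
  forall x w, Einf x w -> forall eps : R, 0 < eps -> exists n : nat,
    forall t, Einf x t -> (forall i, (i < n)%N -> t i = w i) ->
      `|phi x t - phi x w| < eps.

Definition summable_potential (alpha : R) : Prop :=
  [/\ measurable_fun Omega (fun p : T * Seq => phi p.1 p.2),
      phi_continuous,
      (ess_sup m (fun x => v_alpha alpha (Einf x) (phi x)) < +oo)%E,
      (forall e : nat, exists c C : R, [/\ 0 < c, c < C &
          \forall x \ae m, forall w, cylF [set e] x w ->
             c <= expR (phi x w) <= C]) &
      ((fun l : nat => ess_sup m (fun x =>
          ereal_sup [set Lop x (ind (Einf x `\` cylF [set e | (e <= l)%N] x)) w
                    | w in Einf (theta x)])) @ \oo --> 0%E)].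

Definition condA : Prop :=
  forall e : nat, exists M : R, 0 < M /\
    \forall x \ae m, forall w, cylF [set e] (theta x) w ->
      ((M^-1)%:E <= Lop x one w)%E.

Definition condB : Prop :=
  (fun e : nat => ess_sup m (fun x =>
      ereal_sup [set Lop x one w | w in cylF [set e] (theta x)])) @ \oo --> 0%E.

Definition condC : Prop :=
  exists (kappa : R) (F : set nat), [/\ 0 < kappa, kappa < 4^-1, finite_set F &
    \forall x \ae m,
      (ereal_sup [set Lop x (ind (Einf x `\` cylF F x)) w | w in Einf (theta x)]
       <= kappa%:E * ereal_inf [set Lop x one w | w in cylF F (theta x)])%E].

Definition fine_pair (alpha : R) : Prop :=
  [/\ summable_potential alpha, condA, condB & condC].

End Defs.

Section Standing.
Context {d : measure_display} {T : measurableType d} {R : realType}.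
Variables (m : {measure set T -> \bar R}) (theta : T -> T)
  (A : T -> nat -> nat -> bool).

Definition invertible_measurable : Prop :=
  exists thinv : T -> T, [/\ cancel theta thinv, cancel thinv theta,
    measurable_fun setT theta & measurable_fun setT thinv].

Definition measure_preserving : Prop :=
  forall B : set T, measurable B -> m (theta @^-1` B) = m B.

Definition A_measurable : Prop :=
  forall i j : nat, measurable_fun setT (fun x => A x i j).

Definition top_mixing : Prop :=
  forall a b : nat, exists N : nat, forall n : nat, (N <= n)%N -> forall x : T,
    exists w : nat -> nat, [/\ w 0%N = a, w n.+2 = b & adm_word theta A x n.+2 w].

Definition finite_range : Prop :=
  forall e : nat, exists D : seq nat,
    \forall x \ae m, forall j, A x e j -> j \in D.

Definition bounded_access : Prop :=
  forall b : nat, exists bstar : nat,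
    \forall x \ae m, exists a : nat, (a <= bstar)%N /\ A x a b.

End Standing.

Section RandomMeasure.
Context {d : measure_display} {T : measurableType d} {R : realType}.
Variables (theta : T -> T) (A : T -> nat -> nat -> bool).

(* A random measure given through its disintegration (nu_x)_x : Borel
   probability measures on E^N carried by E_x^infty, measurable in x. *)
Definition random_measure (nu : T -> probability Seq R) : Prop :=
  (forall x, nu x (Einf theta A x) = 1%E) /\
  (forall B : set Seq, measurable B -> measurable_fun [set: T] (fun x => nu x B)).

End RandomMeasure.

(* Main.v *)
(* For x in a theta-invariant set of full measure, the transfer operators act on
   functions of bounded log-distortion. Mixing, the tail condition and the lower
   bound (A) at the letter 0 make L^n 1 at any point comparable with its value on
   [0], so that most of the mass of L^n is carried by a finite set of letters. A
   Doeblin-type argument then contracts the oscillation of L_x^n 1_[s] / L_x^n 1,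
   and these ratios, evaluated along a measurable selection of points, converge.
   The limits are a consistent family of cylinder masses, hence define nu_x, and
   lam_x is the limit of L_x^{n+1} 1 / L_{theta x}^n 1. Conformality holds on
   cylinders of length n up to a factor tending to 1, and then exactly by
   summing over longer and longer cylinders. *)
Require Import Defs.
From HB Require Import structures.
From mathcomp Require Import all_boot all_order all_algebra.
From mathcomp Require Import all_classical all_reals all_analysis.
From mathcomp Require Import measurable_realfun ess_sup_inf.
From mathcomp Require Import zify ring lra.
Import Order.TTheory GRing.Theory Num.Theory.
Import numFieldNormedType.Exports.
Local Open Scope classical_set_scope.
Local Open Scope ring_scope.
Set Implicit Arguments.
Unset Strict Implicit.
Unset Printing Implicit Defensive.

(** * Contraction of random transfer operators *)

(** By (B), L_x 1 tends to 0 at large letters, so L^n 1 cannot be controlled uniformly over all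
    points. The way around is a race between two exponentials: n-step returns to 0 have weight at
    least c^n, and since c is fixed before the cutoff [l0], the weight above [l0] can be made at
    most c / 2, which makes long excursions above [l0] negligible against returns. The resulting
    constants do not depend on x, nor on the letter of the evaluation point; that letter only
    affects the waiting time. The Doeblin proportion delta depends on the length D of the cylinder,
    hence on the accuracy wanted, so no fixed geometric rate is at hand and the oscillation is
    driven to 0 by an infimum argument. Building nu_x from limits of explicit ratios, rather than
    from a fixed point or by compactness, gives measurability in x directly: cylinder masses and
    lam_x are pointwise limits of measurable functions. *)

Definition agree (n : nat) (v w : Seq) : Prop := forall i, (i < n)%N -> w i = v i.

Definition cyl (n : nat) (v : Seq) : set Seq := [set w | agree n v w].

Definition at_letter (a : nat) : set Seq := [set w : Seq | w 0%N = a].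

Definition above (l : nat) : set Seq := [set w : Seq | (l < w 0%N)%N].

Definition bnd {R : realType} (g : Seq -> R) : Prop := exists C : R, forall w, `|g w| <= C.

(** * Bounded functions of sequences *)

Section Bounded.
Variable R : realType.
Implicit Types g h : Seq -> R.

Lemma bnd_lin a b g h : bnd g -> bnd h -> bnd (fun v => a * g v + b * h v).
Proof.
move=> [C gC] [D hD]; exists (`|a| * C + `|b| * D) => w.
by rewrite (le_trans (ler_normD _ _))// !normrM lerD// ler_wpM2l.
Qed.

Lemma bnd_mul g h : bnd g -> bnd h -> bnd (fun v => g v * h v).
Proof.
move=> [C gC] [D hD]; exists (C * D) => w.
by rewrite normrM ler_pM.
Qed.

Lemma bnd_ind (B : set Seq) : bnd (\1_B : Seq -> R).
Proof. by exists 1 => w; rewrite indicE; case: (_ \in _); rewrite /= ?normr1 ?normr0. Qed.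

Lemma bnd_cst (a : R) : bnd (fun=> a).
Proof. by exists `|a|. Qed.

Lemma bnd_Z a g : bnd g -> bnd (fun v => a * g v).
Proof. exact: bnd_mul (bnd_cst a). Qed.

Lemma ind_ge0 (B : set Seq) v : 0 <= (\1_B : Seq -> R) v.
Proof. by rewrite indicE. Qed.

Lemma pow_small (q e : R) : 0 <= q -> q < 1 -> 0 < e ->
  exists r0, forall r, (r0 <= r)%N -> q ^+ r <= e.
Proof.
move=> q0 q1 e0; have qn : `|q| < 1 by rewrite ger0_norm.
have /cvgrPdist_le/(_ e e0)[r0 _ Hr] := cvg_expr qn.
by exists r0 => r /Hr; rewrite sub0r normrN ger0_norm// exprn_ge0.
Qed.

End Bounded.

(** * Weighted transfer operators, their iterates and their distortion *)

Section Transfer.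
Variables (R : realType) (X : Type) (theta : X -> X) (E : X -> set Seq).
Variables (W : X -> Seq -> R) (M : R).

(** Admissibility of the prepended letter is carried by the weight, which vanishes off [E x]; hence
    a sum over all letters without any test on [e]. *)
Definition L (x : X) (g : Seq -> R) (w : Seq) : R :=
  limn (series (fun e => W x (scons e w) * g (scons e w))).

Fixpoint Ln (x : X) (n : nat) (g : Seq -> R) : Seq -> R :=
  if n is k.+1 then L (iter k theta x) (Ln x k g) else g.

Lemma Ln_add x a b g : Ln x (b + a) g = Ln (iter a theta x) b (Ln x a g).
Proof. by elim: b => //= b ->; rewrite iterD. Qed.

Lemma LnS x n g : Ln x n.+1 g = L (iter n theta x) (Ln x n g).
Proof. by []. Qed.

Lemma Ln0 x g : Ln x 0 g = g.
Proof. by []. Qed.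

Lemma Ln_1 x n g : Ln x n.+1 g = Ln (theta x) n (L x g).
Proof. by rewrite -addn1 Ln_add. Qed.

Hypothesis M_gt0 : 0 < M.
Hypothesis W_ge0 : forall x w, 0 <= W x w.
Hypothesis W_sum : forall x w n, series (fun e => W x (scons e w)) n <= M.
Hypothesis W_out : forall x w, ~ E x w -> W x w = 0.

Lemma W_cvg x w : cvgn (series (fun e => W x (scons e w))).
Proof.
apply: nondecreasing_is_cvgn; first exact: nondecreasing_series.
by exists M => _ [n _ <-].
Qed.

Lemma L_cvg x g w : bnd g ->
  cvgn (series (fun e => W x (scons e w) * g (scons e w))).
Proof.
move=> [C gC]; apply: normed_cvg => /=.
apply: (@series_le_cvg _ _ (C *: (fun e => W x (scons e w)))).
- by move=> n; exact: normr_ge0.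
- by move=> n; rewrite mulr_ge0// (le_trans _ (gC (fun=> 0%N))).
- by move=> n; rewrite /= normrM ger0_norm// mulrC ler_wpM2r.
- exact/is_cvg_seriesZ/W_cvg.
Qed.

Lemma L_le x g h w : bnd g -> bnd h -> (forall v, E x v -> g v <= h v) ->
  L x g w <= L x h w.
Proof.
move=> bg bh gh; apply: lim_series_le; [exact: L_cvg|exact: L_cvg|move=> n].
have [Ev|nEv] := pselect (E x (scons n w)); last by rewrite W_out// !mul0r.
by rewrite ler_wpM2l// gh.
Qed.

Lemma L_lin x a b g h w : bnd g -> bnd h ->
  L x (fun v => a * g v + b * h v) w = a * L x g w + b * L x h w.
Proof.
move=> bg bh; rewrite /L.
have -> : (fun e => W x (scons e w) * (a * g (scons e w) + b * h (scons e w))) =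
   a *: (fun e => W x (scons e w) * g (scons e w)) +
   b *: (fun e => W x (scons e w) * h (scons e w)).
  by apply/funext => e /=; rewrite !fctE/= /GRing.scale/=; ring.
rewrite lim_seriesD; [|exact/is_cvg_seriesZ/L_cvg|exact/is_cvg_seriesZ/L_cvg].
by rewrite !lim_seriesZ//; exact: L_cvg.
Qed.

Lemma L_1le x w : L x (fun=> 1) w <= M.
Proof.
apply: limr_le; first exact: L_cvg (bnd_cst _).
apply: nearW => n; rewrite (_ : (fun e => _) = (fun e => W x (scons e w))).
  exact: W_sum.
by apply/funext => e; rewrite mulr1.
Qed.

Lemma L_bnd x g : bnd g -> bnd (L x g).
Proof.
move=> bg; have [C gC] := bg; exists (C * M) => w.
have C0 : 0 <= C by rewrite (le_trans _ (gC (fun=> 0%N))).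
have lin0 a : L x (fun v => a * 1 + 0 * 1) w = a * L x (fun=> 1) w.
  by rewrite L_lin ?mul0r ?addr0//; exact: bnd_cst.
rewrite ler_norml; apply/andP; split.
  apply: (@le_trans _ _ (L x (fun v => - C * 1 + 0 * 1) w)).
    by rewrite lin0 mulNr lerN2 ler_wpM2l// L_1le.
  apply: L_le; [apply: bnd_lin; exact: bnd_cst|exact: bg|].
  by move=> v _; rewrite mulr1 mul0r addr0; have := gC v; rewrite ler_norml => /andP[].
apply: (@le_trans _ _ (L x (fun v => C * 1 + 0 * 1) w)).
  apply: L_le; [exact: bg|apply: bnd_lin; exact: bnd_cst|].
  by move=> v _; rewrite mulr1 mul0r addr0; have := gC v; rewrite ler_norml => /andP[].
by rewrite lin0 ler_wpM2l// L_1le.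
Qed.

Lemma Ln_bnd x n g : bnd g -> bnd (Ln x n g).
Proof. by move=> bg; elim: n => //= n IH; exact: L_bnd. Qed.

Lemma Ln_le x n g h w : bnd g -> bnd h -> (forall v, E x v -> g v <= h v) ->
  E (iter n theta x) w -> Ln x n g w <= Ln x n h w.
Proof.
move=> bg bh gh; elim: n w => [w /gh //|n IH w _ /=].
apply: L_le; [exact: Ln_bnd|exact: Ln_bnd|exact: IH].
Qed.

Lemma Ln_lin x n a b g h w : bnd g -> bnd h ->
  Ln x n (fun v => a * g v + b * h v) w = a * Ln x n g w + b * Ln x n h w.
Proof.
move=> bg bh; elim: n w => //= n IH w; rewrite (funext IH).
by rewrite L_lin//; exact: Ln_bnd.
Qed.

Lemma Ln_Z x n a g w : bnd g -> Ln x n (fun v => a * g v) w = a * Ln x n g w.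
Proof.
move=> bg; rewrite -[RHS]addr0 -[X in _ + X](mul0r (Ln x n g w)) -Ln_lin//.
by congr (Ln x n _ w); apply/funext => v; rewrite mul0r addr0.
Qed.

Lemma Ln_ge0 x n g w : bnd g -> (forall v, E x v -> 0 <= g v) ->
  E (iter n theta x) w -> 0 <= Ln x n g w.
Proof.
move=> bg g0 Ew; have := @Ln_le x n (fun v => 0 * g v) g w.
rewrite Ln_Z// mul0r; apply => //.
  exact: bnd_Z.
by move=> v Ev; rewrite mul0r g0.
Qed.

Lemma Ln_ind_ge0 x n (B : set Seq) w : E (iter n theta x) w ->
  0 <= Ln x n (\1_B) w.
Proof. by move=> Ew; apply: Ln_ge0 => //; exact: bnd_ind. Qed.

Lemma Ln_1le x n w : E (iter n theta x) w -> Ln x n (fun=> 1) w <= M ^+ n.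
Proof.
elim: n w => [w _|n IH w Ew]; first by rewrite expr0.
rewrite /= (le_trans (@L_le _ _ (fun v => M ^+ n * 1) _ _ _ _))//.
- exact: Ln_bnd (bnd_cst _).
- exact: bnd_cst.
- by move=> v Ev; rewrite mulr1 IH.
- have -> : (fun v : Seq => M ^+ n * 1) = (fun v : Seq => M ^+ n * 1 + 0 * 1) :> (Seq -> R).
    by apply/funext => v; rewrite mul0r addr0.
  rewrite L_lin; [|exact: bnd_cst|exact: bnd_cst].
  by rewrite mul0r addr0 exprSr ler_wpM2l ?exprn_ge0 ?(ltW M_gt0)// L_1le.
Qed.


Local Opaque L Ln.

Variables (V th dA : R).
Hypothesis V_ge0 : 0 <= V.
Hypothesis th_gt0 : 0 < th.
Hypothesis th_lt1 : th < 1.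
Hypothesis dA_gt0 : 0 < dA.

Hypothesis W_dist : forall x e D w w', (0 < D)%N -> E (theta x) w -> E (theta x) w' ->
  agree D w w' -> W x (scons e w) <= expR (V * th ^+ D.+1) * W x (scons e w').

Hypothesis W_tail : forall eta : R, 0 < eta ->
  exists l, forall x w, L x (\1_(above l)) w <= eta.

(** The word [v] may depend on x, but [c] may not. Asking for a whole cylinder of length k, and not
    just for its first letter, is what yields a Doeblin minorisation at every depth. *)
Hypothesis W_mix : forall a b, exists N, forall k, (N <= k)%N -> exists c : R, 0 < c /\
  forall x, exists v : Seq, v 0%N = a /\
    forall w, E (iter k theta x) w -> w 0%N = b -> c <= Ln x k (\1_(cyl k v)) w.

Hypothesis W_low : forall x w, E (theta x) w -> w 0%N = 0%N -> dA <= L x (fun=> 1) w.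

Local Notation one := (fun _ : Seq => 1 : R).
Local Notation ind_ B := (\1_B : Seq -> R).

Lemma indT_le (B C : set Seq) v : B `<=` C -> ind_ B v <= ind_ C v.
Proof.
move=> BC; rewrite !indicE ler_nat; case: (boolP (v \in B)) => // /set_mem/BC vC.
by rewrite mem_set.
Qed.

Lemma Ln_ind_le x n (B C : set Seq) w : B `<=` C -> E (iter n theta x) w ->
  Ln x n (ind_ B) w <= Ln x n (ind_ C) w.
Proof.
move=> BC Ew; apply: Ln_le => //; [exact: bnd_ind|exact: bnd_ind|].
by move=> v _; exact: indT_le.
Qed.

Lemma mix_letter a b : exists N, forall k, (N <= k)%N -> exists c : R, 0 < c /\
  forall x w, E (iter k theta x) w -> w 0%N = b -> c <= Ln x k (ind_ (at_letter a)) w.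
Proof.
have [N HN] := W_mix a b; exists (maxn N 1) => k; rewrite geq_max => /andP[/HN[c [c0 Hc]] k1].
exists c; split=> // x w Ew wb; have [v [va Hv]] := Hc x.
apply: (le_trans (Hv w Ew wb)); apply: Ln_ind_le => // t /(_ 0%N k1).
by rewrite va.
Qed.

(** Mixing gives one constant for each length. Every n >= N is a sum of lengths between N and 2N -
    1, so the minimum over these finitely many lengths, one factor per block, gives a uniform
    exponential rate. *)
Lemma return_rate : exists (c : R) (N : nat), [/\ 0 < c, c <= 1 & forall n x w,
  (N <= n)%N -> E (iter n theta x) w -> w 0%N = 0%N ->
  c ^+ n <= Ln x n (ind_ (at_letter 0)) w].
Proof.
have [N0 HN0] := mix_letter 0 0; pose N := maxn N0 1.
have N1 : (0 < N)%N by rewrite leq_max orbT.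
have [c [c0 c1 Hc]] : exists c : R, [/\ 0 < c, c <= 1 & forall k x w, (N <= k < N + N)%N ->
    E (iter k theta x) w -> w 0%N = 0%N -> c <= Ln x k (ind_ (at_letter 0)) w].
  elim: {2}N => [|p [c [c0 c1 IH]]].
    by exists 1; split=> // k x w /andP[? ?]; lia.
  have [|c' [c'0 Hc']] := HN0 (N + p)%N; first lia.
  exists (Num.min c c'); split; [by rewrite lt_min c0|by rewrite ge_min c1|].
  move=> k x w kp Ew w0; rewrite ge_min.
  have [kE|kN] := eqVneq k (N + p)%N; first by rewrite kE in Ew *; rewrite Hc' ?orbT.
  by rewrite IH//; lia.
exists c, N; split=> // n; elim/ltn_ind: n => n IH x w Nn Ew w0.
have [nN|Nn'] := ltnP n (N + N).
  apply: le_trans (Hc _ _ _ _ Ew w0); last by rewrite Nn.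
  rewrite -[leRHS]expr1 ler_wiXn2l ?(ltW c0)//; lia.
have nE : n = (n - N + N)%N by rewrite subnK.
rewrite {2}nE Ln_add {1}nE addnC exprD.
rewrite {1}nE iterD in Ew.
have IHw := IH (n - N)%N _ (iter N theta x) w _ Ew w0.
apply: (@le_trans _ _ (Ln (iter N theta x) (n - N) (fun v => c ^+ N * ind_ (at_letter 0) v) w)).
  rewrite Ln_Z ?ler_wpM2l ?exprn_ge0 ?(ltW c0)//; last exact: bnd_ind.
  by apply: IHw; lia.
apply: Ln_le => //; [exact/bnd_Z/bnd_ind|exact/Ln_bnd/bnd_ind|].
move=> v Ev; rewrite indicE; have [/set_mem vo|_] := boolP (v \in at_letter 0).
  rewrite mulr1; apply: le_trans (Hc _ _ _ _ Ev vo); last lia.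
  by rewrite -[leRHS]expr1 ler_wiXn2l ?(ltW c0).
by rewrite mulr0 Ln_ind_ge0.
Qed.

(* Log-distortion at scales beyond m; V th / (1 - th) sums the distortions of the
   individual steps, so this class is preserved by L (with m decreasing to 0). *)
Definition dlog x m (f : Seq -> R) := forall D w w', (0 < D)%N -> (m <= D)%N ->
  E x w -> E x w' -> agree D w w' -> f w <= expR (V * th / (1 - th) * th ^+ D) * f w'.

(** Prepending a letter deepens the agreement by one. With B = V th / (1 - th), the weight
    contributes V th^(D+1) and f contributes B th^(D+1), and these add up to exactly B th^D. *)
Lemma L_dlog x m f : bnd f -> (forall v, E x v -> 0 <= f v) -> dlog x m f ->
  dlog (theta x) m.-1 (L x f).
Proof.
move=> bf f0 df D w w' D0 mD Ew Ew' ww'.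
set K := expR _.
have -> : K * L x f w' = limn (series (K *: (fun e => W x (scons e w') * f (scons e w')))).
  by rewrite lim_seriesZ//; exact: L_cvg.
apply: lim_series_le; [exact: L_cvg|exact/is_cvg_seriesZ/L_cvg|move=> e].
rewrite -[leRHS]/(K * (W x (scons e w') * f (scons e w'))).
have Wle := W_dist e D0 Ew Ew' ww'.
have [Es|nEs] := pselect (E x (scons e w)); last first.
  rewrite W_out// mul0r mulr_ge0 ?expR_ge0//.
  have [Es'|nEs'] := pselect (E x (scons e w')); last by rewrite W_out ?mul0r.
  by rewrite mulr_ge0 ?f0.
(* A vanishing weight at the second point forces a vanishing weight at the first, by [W_dist]. *)
have [Es'|nEs'] := pselect (E x (scons e w')); last first.
  rewrite [in leRHS]W_out// mul0r mulr0.
  have : W x (scons e w) = 0.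
    by apply/eqP; rewrite eq_le W_ge0 andbT (le_trans Wle)// W_out ?mulr0.
  by move=> ->; rewrite mul0r.
have fle : f (scons e w) <= expR (V * th / (1 - th) * th ^+ D.+1) * f (scons e w').
  apply: df => //; first by lia.
  by case=> // i; rewrite ltnS => /ww'.
apply: le_trans (ler_pM (W_ge0 _ _) (f0 _ Es) Wle fle) _.
rewrite mulrACA -expRD (_ : _ + _ = V * th / (1 - th) * th ^+ D)//.
by rewrite exprS; field; rewrite subr_eq0 gt_eqF.
Qed.

Lemma Ln_dlog x n m f : bnd f -> (forall v, E x v -> 0 <= f v) -> dlog x m f ->
  dlog (iter n theta x) (m - n) (Ln x n f).
Proof.
move=> bf f0 df; elim: n => [|n IH]; first by rewrite subn0 Ln0.
rewrite subnS LnS; apply: L_dlog => //; first exact: Ln_bnd.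
by move=> v Ev; exact: Ln_ge0.
Qed.

Lemma dlog_cst x (a : R) : 0 <= a -> dlog x 0 (fun=> a).
Proof.
move=> a0 D w w' _ _ _ _ _; rewrite ler_peMl// -[leLHS]expR0 ler_expR.
by rewrite mulr_ge0 ?exprn_ge0 ?(ltW th_gt0)// divr_ge0 ?mulr_ge0 ?subr_ge0 ?(ltW th_gt0) ?(ltW th_lt1).
Qed.

(** * Exponential return rate and comparison of L^n 1 between points *)

Section Rate.
Variables (c : R) (N0 : nat).
Hypothesis c_gt0 : 0 < c.
Hypothesis c_le1 : c <= 1.
Hypothesis rate : forall n x w, (N0 <= n)%N -> E (iter n theta x) w -> w 0%N = 0%N ->
  c ^+ n <= Ln x n (ind_ (at_letter 0)) w.

(** One mixing block connects 0 with the letter of w and [rate] covers the other n - k steps. The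
    letter bound l changes the prefactor but not the rate c. *)
Lemma to_zero l : exists (k : nat) (c' : R), 0 < c' /\ forall n x w, (k <= n)%N ->
  E (iter n theta x) w -> (w 0%N <= l)%N -> c' * c ^+ n <= Ln x n (ind_ (at_letter 0)) w.
Proof.
have c1 n m : (n <= m)%N -> c ^+ m <= c ^+ n by move=> nm; rewrite ler_wiXn2l ?(ltW c_gt0).
have one a : exists (k : nat) (c' : R), 0 < c' /\ forall n x w, (k <= n)%N ->
    E (iter n theta x) w -> w 0%N = a -> c' * c ^+ n <= Ln x n (ind_ (at_letter 0)) w.
  have [k /(_ _ (leqnn k))[c' [c'0 Hc']]] := mix_letter 0 a.
  exists (k + N0)%N, c'; split=> // n x w kn Ew wa.
  have nE : n = (k + (n - k))%N by lia.
  rewrite {2}nE Ln_add; rewrite nE iterD in Ew.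
  apply: (@le_trans _ _ (Ln (iter (n - k) theta x) k
      (fun v => c ^+ (n - k) * ind_ (at_letter 0) v) w)).
    rewrite Ln_Z; last exact: bnd_ind.
    rewrite [c' * _]mulrC.
    by rewrite ler_pM ?exprn_ge0 ?(ltW c_gt0) ?(ltW c'0) ?Hc' ?c1//; lia.
  apply: Ln_le => //; [exact/bnd_Z/bnd_ind|exact/Ln_bnd/bnd_ind|].
  move=> v Ev; rewrite indicE; have [/set_mem vo|_] := boolP (v \in at_letter 0).
    by rewrite mulr1 rate//; lia.
  by rewrite mulr0 Ln_ind_ge0.
elim: l => [|l [k [c' [c'0 IH]]]].
  have [k [c' [c'0 H]]] := one 0%N; exists k, c'; split=> // n x w kn Ew.
  by rewrite leqn0 => /eqP; exact: H.
have [k1 [c'1 [c'10 H]]] := one l.+1; exists (maxn k k1), (Num.min c' c'1).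
split=> [|n x w]; first by rewrite lt_min c'0.
rewrite geq_max => /andP[kn k1n] Ew wl.
have [wE|wN] := eqVneq (w 0%N) l.+1.
  by rewrite (le_trans _ (H n x w k1n Ew wE))// ler_wpM2r ?exprn_ge0 ?(ltW c_gt0)// ge_min lexx orbT.
rewrite (le_trans _ (IH n x w kn Ew _)) ?ler_wpM2r ?exprn_ge0 ?(ltW c_gt0)// ?ge_min ?lexx//; lia.
Qed.

Lemma from_zero l : exists (k : nat) (c' : R), 0 < c' /\ forall n x w a, (k <= n)%N ->
  E (iter n theta x) w -> w 0%N = 0%N -> (a <= l)%N -> c' * c ^+ n <= Ln x n (ind_ (at_letter a)) w.
Proof.
have c1 n m : (n <= m)%N -> c ^+ m <= c ^+ n by move=> nm; rewrite ler_wiXn2l ?(ltW c_gt0).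
have one a : exists (k : nat) (c' : R), 0 < c' /\ forall n x w, (k <= n)%N ->
    E (iter n theta x) w -> w 0%N = 0%N -> c' * c ^+ n <= Ln x n (ind_ (at_letter a)) w.
  have [k /(_ _ (leqnn k))[c' [c'0 Hc']]] := mix_letter a 0.
  exists (k + N0)%N, c'; split=> // n x w kn Ew wa.
  have nE : n = (n - k + k)%N by lia.
  rewrite {2}nE Ln_add; rewrite nE iterD in Ew.
  apply: (@le_trans _ _ (Ln (iter k theta x) (n - k)
      (fun v => c' * ind_ (at_letter 0) v) w)).
    rewrite Ln_Z; last exact: bnd_ind.
    rewrite ler_wpM2l ?(ltW c'0)// (le_trans _ (rate _ Ew wa)) ?c1//; lia.
  apply: Ln_le => //; [exact/bnd_Z/bnd_ind|exact/Ln_bnd/bnd_ind|].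
  move=> v Ev; rewrite [in leLHS]indicE; have [/set_mem vo|_] := boolP (v \in at_letter 0).
    by rewrite mulr1 Hc'.
  by rewrite mulr0 Ln_ind_ge0.
elim: l => [|l [k [c' [c'0 IH]]]].
  have [k [c' [c'0 H]]] := one 0%N; exists k, c'; split=> // n x w a kn Ew w0.
  by rewrite leqn0 => /eqP ->; exact: H.
have [k1 [c'1 [c'10 H]]] := one l.+1; exists (maxn k k1), (Num.min c' c'1).
split=> [|n x w a]; first by rewrite lt_min c'0.
rewrite geq_max => /andP[kn k1n] Ew w0 al.
have [aE|aN] := eqVneq a l.+1.
  rewrite aE (le_trans _ (H n x w k1n Ew w0))// ler_wpM2r ?exprn_ge0 ?(ltW c_gt0)//.
  by rewrite ge_min lexx orbT.
rewrite (le_trans _ (IH n x w a kn Ew w0 _)) ?ler_wpM2r ?exprn_ge0 ?(ltW c_gt0)// ?ge_min ?lexx//; lia.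
Qed.

Variables (l0 k : nat) (cF : R).
Hypothesis cF_gt0 : 0 < cF.
Hypothesis tail0 : forall x w, L x (\1_(above l0)) w <= c / 2.
Hypothesis kN0 : (N0 <= k)%N.
Hypothesis toF : forall n x w, (k <= n)%N -> E (iter n theta x) w -> (w 0%N <= l0)%N ->
  cF * c ^+ n <= Ln x n (ind_ (at_letter 0)) w.
Hypothesis fromF : forall n x w a, (k <= n)%N -> E (iter n theta x) w -> w 0%N = 0%N ->
  (a <= l0)%N -> cF * c ^+ n <= Ln x n (ind_ (at_letter a)) w.

Lemma split_above l (v : Seq) :
  (1 : R) = 1 * ind_ (~` above l) v + 1 * ind_ (above l) v.
Proof.
rewrite !mul1r !indicE in_setC; by case: (_ \in _); rewrite /= ?addr0 ?add0r.
Qed.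

Lemma Ln_add_le x a b w : E (iter (b + a) theta x) w ->
  Ln x (b + a) one w <= M ^+ a * Ln (iter a theta x) b one w.
Proof.
rewrite Ln_add iterD => Ew; rewrite -Ln_Z; last exact: bnd_cst.
apply: Ln_le => //; [exact/Ln_bnd/bnd_cst|exact/bnd_Z/bnd_cst|].
by move=> v Ev; rewrite mulr1 Ln_1le.
Qed.

(* Induction on r, splitting according to whether the letter at time s is at most
   l0 (then 0 is reached at a bounded cost) or not (then a factor c / 2 is gained). *)
Lemma visit_zero_aux s r x w : (k <= s)%N -> E (iter (r + s) theta x) w ->
  Ln (iter s theta x) r one w <=
  2 / (cF * c ^+ s) * Ln x (r + s) (ind_ (at_letter 0)) w + (c / 2) ^+ r.
Proof.
elim: r s x => [|r IH] s x ks Ew.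
  rewrite expr0 Ln0 lerDr mulr_ge0 ?divr_ge0 ?mulr_ge0 ?exprn_ge0 ?(ltW c_gt0) ?(ltW cF_gt0)//.
  by exact: Ln_ind_ge0.
set Xn := Ln x _ _ w; set y := iter s theta x.
have Ey : E (iter r.+1 theta y) w by rewrite -iterD.
have -> : one = fun v => 1 * ind_ (~` above l0) v + 1 * ind_ (above l0) v.
  by apply/funext => v; exact: split_above.
rewrite Ln_lin; [|exact: bnd_ind|exact: bnd_ind]; rewrite !mul1r.
have cc : 0 < cF * c ^+ s by rewrite mulr_gt0 ?exprn_gt0.
have H1 : Ln y r.+1 (ind_ (~` above l0)) w <= (cF * c ^+ s)^-1 * Xn.
  rewrite mulrC ler_pdivlMr// mulrC /Xn Ln_add -/y -Ln_Z; last exact: bnd_ind.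
  apply: Ln_le => //; [exact/bnd_Z/bnd_ind|exact/Ln_bnd/bnd_ind|].
  move=> v Ev; rewrite indicE; have [/set_mem vo|_] := boolP (v \in ~` above l0).
    by rewrite mulr1; apply: toF => //; move: vo; rewrite /above /= ; lia.
  by rewrite mulr0 Ln_ind_ge0.
have H2 : Ln y r.+1 (ind_ (above l0)) w <= c / 2 * Ln (theta y) r one w.
  rewrite Ln_1 -Ln_Z; last exact: bnd_cst.
  apply: Ln_le => //; [exact/L_bnd/bnd_ind|exact/bnd_Z/bnd_cst| |].
    by move=> v _; rewrite mulr1.
  by rewrite -iterSr.
have := IH s.+1 x; rewrite addnS => /(_ (leqW ks) Ew); rewrite -/Xn -/y /= => H3.
have {}H2 : Ln y r.+1 (ind_ (above l0)) w <=
    c / 2 * (2 / (cF * c ^+ s.+1) * Xn + (c / 2) ^+ r).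
  by apply: le_trans H2 _; rewrite ler_wpM2l ?divr_ge0 ?(ltW c_gt0)//.
(* The constant 2 reproduces itself because 1 + (c / 2) (2 / c) = 2. *)
apply: (le_trans (lerD H1 H2)); rewrite le_eqVlt; apply/orP; left; apply/eqP.
rewrite !exprS; field; rewrite ?gt_eqF ?exprn_gt0//.
Qed.

(** In [visit_zero_aux] at s = k the remainder (c / 2)^(n - k) carries an extra 2^-(n - k), so it
    eventually drops below the lower bound c1 c^n of [to_zero]. The letter bound l enters through c1
    only, hence the waiting time K and not H. *)
Lemma visit_zero : exists H : R, 0 < H /\ forall l, exists K, forall n x w,
  (K <= n)%N -> E (iter n theta x) w -> (w 0%N <= l)%N ->
  Ln x n one w <= H * Ln x n (ind_ (at_letter 0)) w.
Proof.
have ck := exprn_gt0 k c_gt0.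
exists (M ^+ k * (2 / (cF * c ^+ k) + (c ^+ k)^-1)); split.
  by rewrite mulr_gt0 ?exprn_gt0// addr_gt0 ?invr_gt0 ?divr_gt0// mulr_gt0.
move=> l; have [k1 [c1 [c10 H1]]] := to_zero l.
have [|||r0 Hr0] := @pow_small R 2^-1 c1; [lra|lra|by []|].
exists (maxn k1 (k + r0)) => n x w; rewrite geq_max => /andP[k1n krn] Ew wl.
have nE : n = (n - k + k)%N by rewrite subnK// (leq_trans _ krn)// leq_addr.
set Xn := Ln x n (ind_ (at_letter 0)) w.
have XH : c1 * c ^+ n <= Xn by exact: H1.
have A1 : Ln x n one w <= M ^+ k * Ln (iter k theta x) (n - k) one w.
  by rewrite {1}nE Ln_add_le// -nE.
apply: (le_trans A1); rewrite -mulrA ler_wpM2l ?exprn_ge0 ?(ltW M_gt0)//.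
rewrite nE in Ew; have := visit_zero_aux (leqnn k) Ew; rewrite -nE -/Xn => A2.
apply: (le_trans A2); rewrite [leRHS]mulrDl lerD2l [leRHS]mulrC ler_pdivlMr//.
apply: le_trans XH; rewrite {2}nE exprD mulrA ler_wpM2r ?(ltW ck)//.
rewrite exprMn mulrC ler_wpM2r ?exprn_ge0 ?(ltW c_gt0)// Hr0// leq_subRL//.
by rewrite (leq_trans _ krn)// leq_addr.
Qed.

Let B := V * th / (1 - th).

Lemma distortion_one x n v w : E (iter n theta x) v -> E (iter n theta x) w ->
  v 0%N = w 0%N -> Ln x n one v <= expR B * Ln x n one w.
Proof.
move=> Ev Ew vw.
have := @Ln_dlog x n 0 one (bnd_cst 1) (fun _ _ => ler01) (@dlog_cst x 1 ler01) 1%N v w.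
move=> /(_ isT isT Ev Ew) H; apply: (le_trans (H _)); first by case=> // _; rewrite vw.
rewrite ler_wpM2r ?ler_expR//; last first.
  by rewrite expr1 ler_piMr ?(ltW th_lt1)// divr_ge0 ?mulr_ge0 ?subr_ge0 ?(ltW th_gt0) ?(ltW th_lt1).
by apply: Ln_ge0 => //; exact: bnd_cst.
Qed.

(** The letter of v is arbitrary, so the last step is split at [l0]. Letters up to [l0] are joined
    to 0 in r + 1 steps at cost [cF * c ^+ r.+1] and compared through distortion; above [l0] the
    induction hypothesis loses a factor 1 / c while the tail gains c / 2. The condition on C makes
    each of the two parts at most half of the bound. *)
Lemma sup_le_zero_aux C r s x y v : 0 < C -> 2 * M * expR B <= C * cF * c -> (k <= r)%N ->
  1 <= C ->
  E (iter (r + s) theta x) y -> y 0%N = 0%N -> E (iter s theta x) v ->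
  Ln x s one v <= C / c ^+ r * Ln x (r + s) one y.
Proof.
move=> C0 Cb + C1; elim: s r v => [|s IH] r v kr Ey y0 Ev.
  rewrite Ln0 mulrAC ler_pdivlMr ?exprn_gt0// mul1r addn0 -[leLHS]mul1r.
  rewrite addn0 in Ey; apply: ler_pM => //; first by rewrite exprn_ge0 ?(ltW c_gt0).
  apply: le_trans (rate _ Ey y0) _; first exact: leq_trans kN0 kr.
  apply: Ln_le => [||u _|]; [exact: bnd_ind|exact: bnd_cst| |exact: Ey].
  by rewrite indicE lern1 leq_b1.
set U := Ln x (r + s.+1) one y.
have U0 : 0 <= U by apply: Ln_ge0 => //; exact: bnd_cst.
have ESr : (r + s.+1 = r.+1 + s)%N by rewrite addnS.
have IH' t : E (iter s theta x) t -> Ln x s one t <= C / c ^+ r.+1 * U.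
  by move=> Et; rewrite /U ESr; apply: IH => //; [exact: leqW|rewrite -ESr].
have inF t : E (iter s theta x) t -> (t 0%N <= l0)%N ->
    Ln x s one t <= expR B / (cF * c ^+ r.+1) * U.
  move=> Et tl; rewrite mulrAC ler_pdivlMr ?mulr_gt0 ?exprn_gt0//.
  rewrite -ler_pdivrMl ?expR_gt0// /U ESr Ln_add.
  have Ey' : E (iter r.+1 theta (iter s theta x)) y by rewrite -iterD -ESr.
  apply: (@le_trans _ _ (Ln (iter s theta x) r.+1
    (fun v => ((expR B)^-1 * Ln x s one t) * ind_ (at_letter (t 0%N)) v) y)).
    rewrite Ln_Z; last exact: bnd_ind.
    rewrite mulrA ler_wpM2l//.
      by rewrite mulr_ge0 ?invr_ge0 ?expR_ge0//; apply: Ln_ge0 => //; exact: bnd_cst.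
    by rewrite fromF// leqW.
  apply: Ln_le => //; [exact/bnd_Z/bnd_ind|exact/Ln_bnd/bnd_cst|].
  move=> u Eu; rewrite indicE; have [/set_mem ut|_] := boolP (u \in _).
    by rewrite mulr1 ler_pdivrMl ?expR_gt0// distortion_one.
  by rewrite mulr0; apply: Ln_ge0 => //; exact: bnd_cst.
rewrite LnS.
pose a := expR B / (cF * c ^+ r.+1) * U; pose b := C / c ^+ r.+1 * U.
have a0 : 0 <= a by rewrite mulr_ge0// divr_ge0 ?expR_ge0// mulr_ge0 ?exprn_ge0 ?(ltW c_gt0) ?(ltW cF_gt0).
have b0 : 0 <= b by rewrite mulr_ge0// divr_ge0 ?exprn_ge0 ?(ltW c_gt0) ?(ltW C0).
apply: (@le_trans _ _ (L (iter s theta x) (fun t => a * 1 + b * ind_ (above l0) t) v)).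
  apply: L_le; [exact/Ln_bnd/bnd_cst|apply: bnd_lin; [exact: bnd_cst|exact: bnd_ind]|].
  move=> t Et; rewrite indicE; have [_|/negP tl] := boolP (t \in _).
    by rewrite !mulr1 ler_wpDl// IH'.
  rewrite mulr1 mulr0 addr0 inF//.
  by rewrite leqNgt; apply/negP => tl'; apply: tl; rewrite inE.
rewrite L_lin; [|exact: bnd_cst|exact: bnd_ind].
apply: (@le_trans _ _ (a * M + b * (c / 2))).
  by rewrite lerD// ler_wpM2l// L_1le.
rewrite /a /b -/U !(mulrAC _ U) -mulrDl ler_wpM2r// exprS.
have cr := exprn_gt0 r c_gt0.
rewrite (_ : _ + _ = (2 * M * expR B + C * cF * c) / (2 * cF * c) / c ^+ r); last first.
  by field; rewrite !gt_eqF.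
rewrite ler_wpM2r ?invr_ge0 ?(ltW cr)// ler_pdivrMr ?mulr_gt0//; lra.
Qed.

(** The auxiliary bound with r = k compares time n - k with time n; the last k steps above w cost at
    most M^k. *)
Lemma sup_le_zero : exists (H : R) (K : nat), 0 < H /\ forall n x w y,
  (K <= n)%N -> E (iter n theta x) w -> E (iter n theta x) y -> y 0%N = 0%N ->
  Ln x n one w <= H * Ln x n one y.
Proof.
pose C := 1 + 2 * M * expR B / (cF * c).
have P0 : 0 < 2 * M * expR B / (cF * c) by rewrite divr_gt0 ?mulr_gt0 ?expR_gt0.
have C1 : 1 <= C by rewrite lerDl ltW.
have C0 : 0 < C by exact: lt_le_trans C1.
have CB : 2 * M * expR B <= C * cF * c.
  rewrite -[leRHS]mulrA -ler_pdivrMr ?mulr_gt0// /C; lra.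
exists (C / c ^+ k * M ^+ k), k; split.
  by rewrite mulr_gt0 ?divr_gt0 ?exprn_gt0.
move=> n x w y kn Ew Ey y0.
have nE : n = (k + (n - k))%N by rewrite subnKC.
rewrite {1}nE Ln_add; rewrite {1}nE iterD in Ew.
apply: (@le_trans _ _ (Ln (iter (n - k) theta x) k
   (fun v => C / c ^+ k * Ln x n one y * 1) w)).
  apply: Ln_le => //; [exact/Ln_bnd/bnd_cst|exact/bnd_Z/bnd_cst|].
  move=> v Ev; rewrite mulr1 {2}nE; apply: sup_le_zero_aux => //.
  by rewrite -nE.
rewrite Ln_Z; last exact: bnd_cst.
rewrite [leRHS]mulrAC ler_wpM2l ?Ln_1le//.
by rewrite mulr_ge0 ?divr_ge0 ?exprn_ge0 ?(ltW C0) ?(ltW c_gt0)// Ln_ge0//; exact: bnd_cst.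
Qed.

End Rate.

Lemma visit_and_sup : exists H : R, [/\ 1 <= H,
  (forall l, exists K, forall n x w, (K <= n)%N -> E (iter n theta x) w -> (w 0%N <= l)%N ->
    Ln x n one w <= H * Ln x n (ind_ (at_letter 0)) w),
  (exists K, forall n x y, (K <= n)%N -> E (iter n theta x) y -> y 0%N = 0%N ->
    0 < Ln x n one y) &
  (exists K, forall n x w y, (K <= n)%N -> E (iter n theta x) w ->
    E (iter n theta x) y -> y 0%N = 0%N -> Ln x n one w <= H * Ln x n one y)].
Proof.
have [c [N0 [c0 c1 rate]]] := return_rate.
(* Order of choice: the rate c, then the cutoff [l0] whose tail is at most half of c, and only then
   the connection constants [cF] and [k], which depend on [l0]. *)
have [l0 tail0] := W_tail (divr_gt0 c0 (ltr0Sn _ 1)).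
have [k1 [c1' [c10 to1]]] := to_zero c0 c1 rate l0.
have [k2 [c2' [c20 fr2]]] := from_zero c0 c1 rate l0.
pose k := maxn N0 (maxn k1 k2); pose cF := Num.min c1' c2'.
have cF0 : 0 < cF by rewrite lt_min c10.
have kN0 : (N0 <= k)%N by rewrite leq_maxl.
have cFn n : cF * c ^+ n <= c1' * c ^+ n /\ cF * c ^+ n <= c2' * c ^+ n.
  by split; rewrite ler_wpM2r ?exprn_ge0 ?(ltW c0)// ge_min lexx ?orbT.
have toF n x w : (k <= n)%N -> E (iter n theta x) w -> (w 0%N <= l0)%N ->
  cF * c ^+ n <= Ln x n (ind_ (at_letter 0)) w.
  rewrite !geq_max => /and3P[_ kn _] Ew wl; apply: le_trans (to1 n x w kn Ew wl).
  by case: (cFn n).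
have fromF n x w a : (k <= n)%N -> E (iter n theta x) w -> w 0%N = 0%N -> (a <= l0)%N ->
  cF * c ^+ n <= Ln x n (ind_ (at_letter a)) w.
  rewrite !geq_max => /and3P[_ _ kn] Ew wl al; apply: le_trans (fr2 n x w a kn Ew wl al).
  by case: (cFn n).
have [H1 [H10 HH1]] := visit_zero c0 c1 rate cF0 tail0 kN0 toF.
have [H2 [K2 [H20 HH2]]] := sup_le_zero c0 rate cF0 tail0 kN0 fromF.
exists (1 + H1 + H2); split; first lra.
  move=> l; have [K HK] := HH1 l; exists K => n x w Kn Ew wl.
  by rewrite (le_trans (HK _ _ _ Kn Ew wl))// ler_wpM2r ?Ln_ind_ge0//; lra.
  exists N0 => n x y Nn Ey y0; apply: lt_le_trans (exprn_gt0 n c0) _.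
  apply: le_trans (rate _ _ _ Nn Ey y0) _.
  apply: Ln_le => [||u _|]; [exact: bnd_ind|exact: bnd_cst| |exact: Ey].
  by rewrite indicE lern1 leq_b1.
exists K2 => n x w y Kn Ew Ey y0; rewrite (le_trans (HH2 _ _ _ _ Kn Ew Ey y0))// ler_wpM2r//.
  by apply: Ln_ge0 => //; exact: bnd_cst.
lra.
Qed.

(** * Decay of the oscillation of L^n f / L^n 1 *)

Section Osc.
Variable H : R.
Hypothesis H1 : 1 <= H.
Hypothesis HP : forall l, exists K, forall n x w, (K <= n)%N -> E (iter n theta x) w ->
  (w 0%N <= l)%N -> Ln x n one w <= H * Ln x n (ind_ (at_letter 0)) w.
Hypothesis Hpos : exists K, forall n x y, (K <= n)%N -> E (iter n theta x) y ->
  y 0%N = 0%N -> 0 < Ln x n one y.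
Hypothesis HS : exists K, forall n x w y, (K <= n)%N -> E (iter n theta x) w ->
    E (iter n theta x) y -> y 0%N = 0%N -> Ln x n one w <= H * Ln x n one y.

Let H0 : 0 < H. Proof. exact: lt_le_trans H1. Qed.

Lemma Ln_one_ge0 x n w : E (iter n theta x) w -> 0 <= Ln x n one w.
Proof. by move=> Ew; apply: Ln_ge0 => //; exact: bnd_cst. Qed.

(** A fixed proportion of the mass passes through the letter 0, where L 1 is at least [dA]; so
    inserting one more initial step loses at most a bounded factor. *)
Lemma Ln_one_succ l : exists K, forall n x w, (K <= n)%N ->
  E (iter n.+1 theta x) w -> (w 0%N <= l)%N ->
  Ln (theta x) n one w <= H / dA * Ln x n.+1 one w.
Proof.
have [K HK] := HP l; exists K => n x w Kn Ew wl.
have Ew' : E (iter n theta (theta x)) w by rewrite -iterSr.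
apply: (le_trans (HK _ _ _ Kn Ew' wl)); rewrite -mulrA ler_wpM2l ?(ltW H0)//.
rewrite ler_pdivlMl// Ln_1 -Ln_Z; last exact: bnd_ind.
apply: Ln_le => //; [exact/bnd_Z/bnd_ind|exact/L_bnd/bnd_cst|].
move=> v Ev; rewrite indicE; have [/set_mem vo|_] := boolP (v \in _).
  by rewrite mulr1 W_low.
by rewrite mulr0; have := @Ln_ge0 x 1 one v (bnd_cst 1) (fun _ _ => ler01) Ev; rewrite LnS Ln0.
Qed.

(** The first step puts at most eta above l', and the remaining steps are compared with those from x
    by [Ln_one_succ]. The waiting time K is chosen before l' and eta. *)
Lemma tail_bound l : exists K, forall l' eta, 0 <= eta ->
  (forall x w, L x (ind_ (above l')) w <= eta) ->
  forall n x w, (K <= n)%N -> E (iter n theta x) w -> (w 0%N <= l)%N ->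
  Ln x n (ind_ (above l')) w <= H / dA * eta * Ln x n one w.
Proof.
have [K HK] := Ln_one_succ l; exists K.+1 => l' eta eta0 Heta [//|n] x w Kn Ew wl.
apply: (@le_trans _ _ (eta * Ln (theta x) n one w)); last first.
  by rewrite -mulrA mulrCA ler_wpM2l// HK.
rewrite Ln_1 -Ln_Z; last exact: bnd_cst.
have Ew' : E (iter n theta (theta x)) w by rewrite -iterSr.
apply: Ln_le => //; [exact/L_bnd/bnd_ind|exact/bnd_Z/bnd_cst|].
by move=> v Ev; rewrite mulr1.
Qed.

(** The first D steps have weight at least c on the cylinder when they end at 0, and at most M^D in
    all; visits to 0 cost H, whence c / (H M^D). Since delta is chosen before l, one proportion
    serves for all letter bounds. *)
Lemma cyl_minor D0 : exists D (delta : R), [/\ (D0 <= D)%N, (0 < D)%N, 0 < delta, delta <= 1 &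
  forall l, exists K, forall x, exists v : Seq, v 0%N = 0%N /\
  forall n w, (K <= n)%N -> E (iter n theta x) w -> (w 0%N <= l)%N ->
  delta * Ln x n one w <= Ln x n (ind_ (cyl D v)) w].
Proof.
have [N HN] := W_mix 0 0; pose D := maxn N (maxn D0 1).
have [c [c0 Hc]] := HN D (leq_maxl _ _).
have MD := exprn_gt0 D M_gt0.
pose delta := Num.min 1 (c / (H * M ^+ D)).
have de0 : 0 < delta by rewrite lt_min ltr01 divr_gt0// mulr_gt0.
exists D, delta; split=> //; [by rewrite !leq_max leqnn !orbT| | |].
- by rewrite /D !leq_max !orbT.
- by rewrite ge_min lexx.
move=> l; have [K HK] := HP l; exists (K + D)%N => x.
have [v [v0 Hv]] := Hc x; exists v; split=> // n w Kn Ew wl.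
have nE : n = (n - D + D)%N by rewrite subnK// (leq_trans _ Kn)// leq_addl.
set y := iter D theta x.
have Ey : E (iter (n - D) theta y) w by rewrite -iterD -nE.
have L1 : Ln x n one w <= M ^+ D * Ln y (n - D) one w by rewrite {1}nE Ln_add_le// -nE.
have L2 : Ln y (n - D) one w <= H * Ln y (n - D) (ind_ (at_letter 0)) w.
  by apply: HK => //; rewrite leq_subRL ?(leq_trans _ Kn) ?leq_addl// addnC.
have L3 : c * Ln y (n - D) (ind_ (at_letter 0)) w <= Ln x n (ind_ (cyl D v)) w.
  rewrite {2}nE Ln_add -Ln_Z; last exact: bnd_ind.
  apply: Ln_le => //; [exact/bnd_Z/bnd_ind|exact/Ln_bnd/bnd_ind|].
  move=> u Eu; rewrite [in leLHS]indicE; have [/set_mem vo|_] := boolP (u \in _).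
    by rewrite mulr1 Hv.
  by rewrite mulr0 Ln_ind_ge0.
apply: le_trans L3.
apply: (@le_trans _ _ (c / (H * M ^+ D) * Ln x n one w)).
  by rewrite ler_wpM2r ?Ln_one_ge0// ge_min lexx orbT.
rewrite -mulrA ler_wpM2l ?(ltW c0)// mulrC ler_pdivrMr ?mulr_gt0//.
apply: (le_trans L1); rewrite mulrC -ler_pdivlMr ?exprn_gt0// mulrA mulfK ?gt_eqF//.
by rewrite mulrC.
Qed.

Variables (x : X) (f : Seq -> R) (m : nat).
Hypothesis f_bnd : bnd f.
Hypothesis f01 : forall v, E x v -> 0 <= f v <= 1.
Hypothesis f_dlog : dlog x m f.
Hypothesis E_zero : forall n, exists w : Seq, E (iter n theta x) w /\ w 0%N = 0%N.

(** The lower end [b] is common to all late times n, which is what makes the ratios Cauchy. The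
    products avoid dividing by a value of L^n 1 that might vanish. *)
Definition osc_le (t : R) := forall l, exists n0 (b : R), 0 <= b /\ forall n w,
  (n0 <= n)%N -> E (iter n theta x) w -> (w 0%N <= l)%N ->
  b * Ln x n one w <= Ln x n f w <= (b + t) * Ln x n one w.

Lemma Lnf_ge0 n w : E (iter n theta x) w -> 0 <= Ln x n f w.
Proof. by move=> Ew; apply: Ln_ge0 => // v /f01/andP[]. Qed.

Lemma Lnf_le n w : E (iter n theta x) w -> Ln x n f w <= Ln x n one w.
Proof. by move=> Ew; apply: Ln_le => //; [exact: bnd_cst|move=> v /f01/andP[]]. Qed.

Lemma osc_le1 : osc_le 1.
Proof.
move=> l; exists 0%N, 0; split=> // n w _ Ew _.
by rewrite mul0r add0r mul1r Lnf_ge0//= Lnf_le.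
Qed.

(** The factor 2 counts the distortion of L^n f and that of L^n 1 in their quotient. *)
Definition err D := expR (2 * (V * th / (1 - th)) * th ^+ D) - 1.

Lemma ratio_close n D y z : (m <= n)%N -> (0 < D)%N -> E (iter n theta x) y ->
  E (iter n theta x) z -> agree D y z -> 0 < Ln x n one y ->
  (Ln x n f y / Ln x n one y - err D) * Ln x n one z <= Ln x n f z <=
  (Ln x n f y / Ln x n one y + err D) * Ln x n one z.
Proof.
move=> mn D0 Ey Ez yz uy; set r := _ / _.
have zy : agree D z y by move=> i /yz ->.
have mn0 : (m - n <= D)%N by rewrite (eqP mn).
have f0 v : E x v -> 0 <= f v by move=> /f01/andP[].
have df := @Ln_dlog x n m f f_bnd f0 f_dlog.
have du := @Ln_dlog x n 0 one (bnd_cst 1) (fun _ _ => ler01) (@dlog_cst x 1 ler01).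
set b := V * th / (1 - th) * th ^+ D.
have f1 := df D z y D0 mn0 Ez Ey zy.
have f2 := df D y z D0 mn0 Ey Ez yz.
have u1 := du D z y D0 isT Ez Ey zy.
have u2 := du D y z D0 isT Ey Ez yz.
rewrite -/b in f1 f2 u1 u2.
have errE : err D = expR b * expR b - 1 by rewrite -expRD /err /b; congr (expR _ - 1); ring.
have rE : Ln x n f y = r * Ln x n one y by rewrite divfK ?gt_eqF.
have r0 : 0 <= r by rewrite divr_ge0 ?Lnf_ge0 ?(ltW uy).
have r1 : r <= 1 by rewrite ler_pdivrMr// mul1r Lnf_le.
have b1 : 1 <= expR b.
  rewrite -[leLHS]expR0 ler_expR mulr_ge0 ?exprn_ge0 ?(ltW th_gt0)//.
  by rewrite divr_ge0 ?mulr_ge0 ?subr_ge0 ?(ltW th_gt0) ?(ltW th_lt1).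
have e0 : 0 < expR b by exact: expR_gt0.
move: f1 f2 u1 u2; rewrite errE rE.
move: (Ln x n one y) (Ln x n one z) (Ln x n f z) uy (Ln_one_ge0 Ez) (Lnf_ge0 Ez) => uy uz fz.
move: (expR b) b1 e0 => e b1 e0 uy0 uz0 fz0 f1 f2 u1 u2.
have ry : r * uy <= r * (e * uz) by rewrite ler_wpM2l.
have rz : r * uz <= r * (e * uy) by rewrite ler_wpM2l.
have ee : 1 <= e * e by rewrite -[leLHS]mulr1 ler_pM.
apply/andP; split; last first.
  apply: (le_trans f1); apply: (@le_trans _ _ (e * (r * (e * uz)))); first by rewrite ler_wpM2l ?(ltW e0).
  have h : 0 <= (e * e - 1) * uz * (1 - r) by rewrite !mulr_ge0// subr_ge0.
  by rewrite -subr_ge0 (_ : _ - _ = (e * e - 1) * uz * (1 - r))//; ring.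
have A : r * uz <= e * e * fz.
  apply: (le_trans rz); rewrite mulrCA -mulrA ler_wpM2l ?(ltW e0)//.
have B1 : e * e * ((r - (e * e - 1)) * uz) <= r * uz.
  have h : 0 <= (e * e - 1) * uz * (e * e - r) by rewrite !mulr_ge0// subr_ge0// (le_trans r1).
  by rewrite -subr_ge0 (_ : _ - _ = (e * e - 1) * uz * (e * e - r))//; ring.
by rewrite -(@ler_pM2l _ (e * e)) ?mulr_gt0// (le_trans B1).
Qed.

(* Doeblin step: at every point with moderate letter, L^n puts a proportion delta on
   one and the same cylinder of length D, where the ratios differ only by err D. *)
Lemma osc_step t D delta l' eta : osc_le t -> 0 <= t -> (m <= D)%N -> (0 < D)%N ->
  0 < delta -> delta <= 1 ->
  (forall l, exists K, forall x, exists v : Seq, v 0%N = 0%N /\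
    forall n w, (K <= n)%N -> E (iter n theta x) w -> (w 0%N <= l)%N ->
    delta * Ln x n one w <= Ln x n (ind_ (cyl D v)) w) ->
  0 <= eta -> (forall x w, L x (ind_ (above l')) w <= eta) ->
  osc_le ((1 - delta / H ^+ 2) * t + 2 * (delta / H ^+ 2) * err D + 2 * (H ^+ 4 / dA * eta)).
Proof.
move=> osc t0 mD D0 de0 de1 minor eta0 Heta l.
have [n0 [b [b0 Hb]]] := osc l'.
have [K1 Pos] := Hpos; have [K2 Sup] := HS.
pose n := maxn (maxn n0 m) (maxn K1 K2).
have n0n : (n0 <= n)%N by rewrite /n !leq_max leqnn.
have mn : (m <= n)%N by rewrite /n !leq_max leqnn orbT.
have K1n : (K1 <= n)%N by rewrite /n !leq_max leqnn !orbT.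
have K2n : (K2 <= n)%N by rewrite /n !leq_max leqnn !orbT.
have [K3 Vis] := HP l; have [K4 Tail] := tail_bound l; have [K5 Min] := minor l.
set xn := iter n theta x.
have [v [v0 Hv]] := Min xn.
pose k0 := maxn (maxn K3 K4) K5.
(* The cylinder carries positive mass at a late base point, so it meets [E xn]. The point y serves
   as reference for all comparisons at time n. *)
have [y [Ey yv]] : exists y, E xn y /\ cyl D v y.
  have [w [Ew w0]] := E_zero (k0 + K1 + n).
  rewrite iterD -/xn in Ew.
  have Kk : (K5 <= k0 + K1)%N by rewrite (leq_trans _ (leq_addr _ _))// /k0 leq_max leqnn orbT.
  have := Hv _ w Kk Ew; rewrite w0 => /(_ isT) h.
  have u0 : 0 < Ln xn (k0 + K1) one w by apply: Pos => //; rewrite leq_addl.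
  apply: contrapT => ne.
  have : Ln xn (k0 + K1) (ind_ (cyl D v)) w <= Ln xn (k0 + K1) (fun=> 0 * 1) w.
    apply: Ln_le => //; [exact: bnd_ind|exact/bnd_Z/bnd_cst|].
    move=> u Eu; rewrite mul0r indicE; have [/set_mem uv|//] := boolP (u \in _).
    by exfalso; apply: ne; exists u.
  rewrite Ln_Z ?mul0r; last exact: bnd_cst.
  by apply/negP; rewrite -ltNge (lt_le_trans _ h)// mulr_gt0.
have y0 : y 0%N = 0%N by rewrite yv.
set U := Ln x n one; set F := Ln x n f.
have Uy0 : 0 < U y by apply: Pos.
have cyl0 z : cyl D v z -> z 0%N = 0%N by move=> zv; rewrite zv.
have /andP[Hby1 Hby2] : b * U y <= F y <= (b + t) * U y by apply: Hb => //; rewrite y0.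
have [r0 r1] : 0 <= F y / U y /\ F y / U y <= b + t.
  split; first by rewrite divr_ge0 ?Lnf_ge0 ?(ltW Uy0).
  by rewrite ler_pdivrMr.
have rb : b <= F y / U y.
  by rewrite ler_pdivlMr.
set r := F y / U y in r0 r1 rb.
have b1 : b <= 1 by rewrite (le_trans rb)// ler_pdivrMr// mul1r Lnf_le.
pose e := err D.
have e0 : 0 <= e.
  by rewrite subr_ge0 -[leLHS]expR0 ler_expR !mulr_ge0 ?exprn_ge0 ?invr_ge0 ?subr_ge0
    ?(ltW th_gt0) ?(ltW th_lt1).
(* Clipping to [b, b + t] keeps b + t - rp and rm - b nonnegative, so that a lower bound on the mass
   of the cylinder can be multiplied by them. *)
pose rp := Num.min (r + e) (b + t); pose rm := Num.max (r - e) b.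
have rpb : rp <= b + t by rewrite ge_min lexx orbT.
have rmb : b <= rm by rewrite le_max lexx orbT.
have rpm : rp - rm <= 2 * e.
  have : rp <= r + e by rewrite ge_min lexx.
  have : r - e <= rm by rewrite le_max lexx.
  lra.
have bU : bnd U by exact/Ln_bnd/bnd_cst.
have bF : bnd F by exact: Ln_bnd.
pose IZ := fun u => ind_ (cyl D v) u * U u.
pose IT := fun u => ind_ (above l') u * U u.
have bIZ : bnd IZ by apply: bnd_mul => //; exact: bnd_ind.
have bIT : bnd IT by apply: bnd_mul => //; exact: bnd_ind.
have U0 u : E xn u -> 0 <= U u by exact: Ln_one_ge0.
have F0 u : E xn u -> 0 <= F u by exact: Lnf_ge0.
have FU u : E xn u -> F u <= U u by exact: Lnf_le.
have onZ u : E xn u -> cyl D v u -> rm * U u <= F u <= rp * U u.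
  move=> Eu uv.
  have yu : agree D y u by move=> i iD; rewrite (uv i iD) (yv i iD).
  have /andP[c1 c2] := ratio_close mn D0 Ey Eu yu Uy0.
  have /andP[c3 c4] : b * U u <= F u <= (b + t) * U u by apply: Hb => //; rewrite cyl0.
  rewrite /rp /rm minr_pMl ?maxr_pMl ?U0// le_min ge_max c3 c4 /e.
  by rewrite c1 c2.
(* Above l' only 0 <= F <= U is known; all of U is counted there as the error [IT]. *)
have upper u : E xn u -> F u <= (b + t) * U u + 1 * (- (b + t - rp) * IZ u + 1 * IT u).
  move=> Eu; rewrite /IZ /IT !indicE.
  have [/set_mem uv|uv] := boolP (u \in cyl D v).
    have /andP[_ h] := onZ u Eu uv.
    have := U0 u Eu; case: (_ \in _) => /=; lra.
  have [/set_mem ua|/negP ua] := boolP (u \in above l').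
    have := FU u Eu; have : 0 <= (b + t) * U u by rewrite mulr_ge0 ?U0// addr_ge0.
    rewrite /=; lra.
  have /andP[_ h] : b * U u <= F u <= (b + t) * U u.
    by apply: Hb => //; rewrite leqNgt; apply/negP => h; apply: ua; rewrite inE.
  rewrite /=; lra.
have lower u : E xn u -> b * U u + 1 * ((rm - b) * IZ u + (-1) * IT u) <= F u.
  move=> Eu; rewrite /IZ /IT !indicE.
  have [/set_mem uv|uv] := boolP (u \in cyl D v).
    have /andP[h _] := onZ u Eu uv.
    have := U0 u Eu; case: (_ \in _) => /=; lra.
  have [/set_mem ua|/negP ua] := boolP (u \in above l').
    have := F0 u Eu; have : b * U u <= U u by rewrite ler_piMl ?U0.
    rewrite /=; lra.
  have /andP[h _] : b * U u <= F u <= (b + t) * U u.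
    by apply: Hb => //; rewrite leqNgt; apply/negP => h; apply: ua; rewrite inE.
  rewrite /=; lra.
(* In d' one H compares U on the cylinder with U y, the other U anywhere with U y. In C0 two factors
   come from the sup bound and [tail_bound], and two from [UR] below. *)
pose d' := delta / H ^+ 2; pose C0 := H ^+ 4 / dA * eta.
have C00 : 0 <= C0 by rewrite mulr_ge0// divr_ge0 ?exprn_ge0 ?(ltW H0) ?(ltW dA_gt0).
(* The maximum with 0 keeps the lower end nonnegative, as [osc_le] requires; this is harmless since
   L^n f >= 0. *)
pose b' := Num.max 0 (b + (rm - b) * d' - C0).
exists (k0 + n)%N, b'; split; first by rewrite le_max lexx.
move=> N w kN; have NE : N = (N - n + n)%N by rewrite subnK// (leq_trans _ kN)// leq_addl.
have kk : (k0 <= N - n)%N by rewrite leq_subRL ?(leq_trans _ kN) ?leq_addl// addnC.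
rewrite NE !Ln_add iterD -/xn -/U -/F; move: (N - n)%N kk => k kk Ew wl.
have kk' : [/\ (K3 <= k)%N, (K4 <= k)%N & (K5 <= k)%N].
  by move: kk; rewrite /k0 !geq_max => /andP[/andP[]].
have [k3 k4 k5] := kk'.
have UHy u : E xn u -> U u <= H * U y by move=> Eu; exact: Sup.
have one0 : 0 <= Ln xn k one w by exact: Ln_one_ge0.
have vis : Ln xn k one w <= H * Ln xn k (ind_ (at_letter 0)) w by exact: Vis.
have UL : Ln xn k U w <= H * U y * Ln xn k one w.
  rewrite -Ln_Z; last exact: bnd_cst.
  by apply: Ln_le => //; [exact/bnd_Z/bnd_cst|move=> u Eu; rewrite mulr1 UHy].
have UR : U y * Ln xn k one w <= H ^+ 2 * Ln xn k U w.
  apply: (@le_trans _ _ (U y * (H * Ln xn k (ind_ (at_letter 0)) w))).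
    by rewrite ler_wpM2l ?(ltW Uy0).
  rewrite mulrCA expr2 -mulrA ler_wpM2l ?(ltW H0)// -!Ln_Z//; last exact: bnd_ind.
  apply: Ln_le => //; [exact/bnd_Z/bnd_ind|exact/bnd_Z|].
  move=> u Eu; rewrite indicE; have [/set_mem u0|_] := boolP (u \in _).
    by rewrite mulr1; apply: Sup.
  by rewrite mulr0 mulr_ge0 ?(ltW H0)// U0.
have Qlow : d' * Ln xn k U w <= Ln xn k IZ w.
  apply: (@le_trans _ _ (d' * (H * U y * Ln xn k one w))).
    by rewrite ler_wpM2l// divr_ge0 ?exprn_ge0 ?(ltW H0) ?(ltW de0).
  rewrite (_ : _ * _ = H^-1 * U y * (delta * Ln xn k one w)); last first.
    by rewrite /d'; field; rewrite gt_eqF.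
  apply: (@le_trans _ _ (H^-1 * U y * Ln xn k (ind_ (cyl D v)) w)).
    by rewrite ler_wpM2l ?mulr_ge0 ?invr_ge0 ?(ltW H0) ?(ltW Uy0)// Hv.
  rewrite -Ln_Z; last exact: bnd_ind.
  apply: Ln_le => //; first exact/bnd_Z/bnd_ind.
  move=> u Eu; rewrite /IZ indicE; have [/set_mem uv|_] := boolP (u \in _).
    by rewrite mulr1 mul1r ler_pdivrMl//; apply: Sup => //; exact: cyl0.
  by rewrite mulr0 mul0r.
have Tup : Ln xn k IT w <= C0 * Ln xn k U w.
  apply: (@le_trans _ _ (H * U y * Ln xn k (ind_ (above l')) w)).
    rewrite -Ln_Z; last exact: bnd_ind.
    apply: Ln_le => //; first exact/bnd_Z/bnd_ind.
    by move=> u Eu; rewrite /IT mulrC ler_wpM2r ?UHy// ind_ge0.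
  apply: (@le_trans _ _ (H * U y * (H / dA * eta * Ln xn k one w))).
    by rewrite ler_wpM2l ?mulr_ge0 ?(ltW H0) ?(ltW Uy0)// Tail.
  rewrite (_ : _ * _ = H ^+ 2 / dA * eta * (U y * Ln xn k one w)); last by rewrite expr2; ring.
  rewrite /C0 (_ : H ^+ 4 / dA * eta = H ^+ 2 / dA * eta * H ^+ 2); last first.
    by field; rewrite gt_eqF.
  by rewrite -[leRHS]mulrA ler_wpM2l// mulr_ge0// divr_ge0 ?exprn_ge0 ?(ltW H0) ?(ltW dA_gt0).
have LU0 : 0 <= Ln xn k U w by apply: Ln_ge0.
have LF0 : 0 <= Ln xn k F w by apply: Ln_ge0.
have up : Ln xn k F w <= (b + t) * Ln xn k U w - (b + t - rp) * Ln xn k IZ w + Ln xn k IT w.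
  apply: (le_trans (Ln_le _ _ upper Ew)) => //.
    by do 2?[apply: bnd_lin => //].
  rewrite !Ln_lin//; last exact: bnd_lin.
  lra.
have lo : b * Ln xn k U w + (rm - b) * Ln xn k IZ w - Ln xn k IT w <= Ln xn k F w.
  apply: (le_trans _ (Ln_le _ _ lower Ew)) => //; last by do 2?[apply: bnd_lin => //].
  rewrite !Ln_lin//; last exact: bnd_lin.
  lra.
have p1 : (b + t - rp) * (d' * Ln xn k U w) <= (b + t - rp) * Ln xn k IZ w.
  by rewrite ler_wpM2l// subr_ge0.
have p2 : (rm - b) * (d' * Ln xn k U w) <= (rm - b) * Ln xn k IZ w.
  by rewrite ler_wpM2l// subr_ge0.
have b'd : b + (rm - b) * d' - C0 <= b' by rewrite le_max lexx orbT.
apply/andP; split.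
  rewrite maxr_pMl// ge_max mul0r LF0/=; apply: le_trans lo; lra.
have d'0 : 0 <= d' by rewrite divr_ge0 ?exprn_ge0 ?(ltW H0) ?(ltW de0).
apply: (le_trans up).
apply: (@le_trans _ _ ((b + t - (b + t - rp) * d' + C0) * Ln xn k U w)); first lra.
rewrite ler_wpM2r//.
have : (rp - rm) * d' <= 2 * e * d' by rewrite ler_wpM2r.
rewrite -/d' -/C0 -/e; lra.
Qed.

(** The contraction factor depends on D, and D on the accuracy, so iterating one fixed step is not
    enough. If the infimum [om] of attainable oscillations were positive, D and eta adapted to [om]
    would turn a value close to [om] into one below it. *)
Lemma osc_small t : 0 < t -> osc_le t.
Proof.
pose S := [set s | 0 <= s /\ osc_le s].
have S0 : S !=set0 by exists 1; split=> //; exact: osc_le1.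
have Slb : has_lbound S by exists 0 => s [].
pose om := inf S.
have om0 : 0 <= om by apply: lb_le_inf => // s [].
have om_near e : 0 < e -> exists s, [/\ 0 <= s, osc_le s & s < om + e].
  by move=> e0; have [s [s0 os] sl] := inf_adherent e0 (conj S0 Slb); exists s.
suff omE : om = 0.
  move=> t0; have [s [s0 os sl]] := om_near t t0.
  move=> l; have [n0 [b [b0 Hb]]] := os l; exists n0, b; split=> // n w n0n Ew wl.
  have /andP[-> /= h] := Hb n w n0n Ew wl; apply: (le_trans h).
  rewrite ler_wpM2r ?Ln_one_ge0// lerD2l; rewrite omE add0r in sl; exact: ltW.
apply/eqP; rewrite eq_le om0 andbT leNgt; apply/negP => om_gt0.
have [D0 HD0] : exists D0, forall D, (D0 <= D)%N -> 2 * err D <= om / 2.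
  pose q := ln (1 + om / 4).
  have q0 : 0 < q by rewrite ln_gt0// ltrDl divr_gt0.
  pose b2 := 2 * (V * th / (1 - th)) + 1.
  have b20 : 0 < b2.
    by rewrite ltr_wpDl// !mulr_ge0 ?invr_ge0 ?subr_ge0 ?(ltW th_gt0) ?(ltW th_lt1).
  have [D0 HD] := pow_small (ltW th_gt0) th_lt1 (divr_gt0 q0 b20).
  exists D0 => D /HD; rewrite ler_pdivlMr// => h.
  suff : err D <= om / 4 by lra.
  rewrite /err lerBlDl -[leRHS]lnK ?posrE ?ltr_pwDl ?divr_ge0 ?(ltW om_gt0)// ler_expR -/q.
  apply: le_trans h; rewrite mulrC ler_wpM2l ?exprn_ge0 ?(ltW th_gt0)//.
  by rewrite /b2 lerDl.
have [D [delta [D0D Dgt de0 de1 minor]]] := cyl_minor (maxn D0 m).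
have [D0D' mD] : (D0 <= D)%N /\ (m <= D)%N by move: D0D; rewrite geq_max => /andP[].
pose d' := delta / H ^+ 2.
have H2 : 1 <= H ^+ 2 by rewrite exprn_ege1.
have d'0 : 0 < d' by rewrite divr_gt0// exprn_gt0.
have d'1 : d' <= 1 by rewrite ler_pdivrMr ?exprn_gt0// mul1r (le_trans de1).
have C0 : 0 < H ^+ 4 / dA by rewrite divr_gt0 ?exprn_gt0.
(* With d' om = 8 e, the step applied to a value below om + e ends at most at om - 2 e. *)
pose e := d' * om / 8.
have e0 : 0 < e by rewrite divr_gt0// mulr_gt0.
pose eta := e / (2 * (H ^+ 4 / dA)).
have eta0 : 0 < eta by rewrite divr_gt0// mulr_gt0.
have [l' Hl'] := W_tail eta0.
have [s [s0 os sl]] := om_near e e0.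
have os' := osc_step os s0 mD Dgt de0 de1 minor (ltW eta0) Hl'.
have E1 : 2 * (H ^+ 4 / dA * eta) = e.
  by rewrite /eta mulrA mulrC divfK// gt_eqF// mulr_gt0.
rewrite E1 -/d' in os'.
have err0 : 0 <= err D.
  by rewrite subr_ge0 -[leLHS]expR0 ler_expR !mulr_ge0 ?exprn_ge0 ?invr_ge0 ?subr_ge0
    ?(ltW th_gt0) ?(ltW th_lt1).
have : om <= (1 - d') * s + 2 * d' * err D + e.
  apply: ge_inf => //; split=> //.
  have p5 : 0 <= (1 - d') * s by rewrite mulr_ge0// subr_ge0.
  have p6 : 0 <= d' * err D by rewrite mulr_ge0// ltW.
  lra.
have p1 : d' * (2 * err D) <= d' * (om / 2) by rewrite ler_wpM2l ?(ltW d'0) ?HD0.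
have p2 : (1 - d') * s <= (1 - d') * (om + e) by rewrite ler_wpM2l ?subr_ge0 ?(ltW sl).
have p3 : 0 <= d' * e by rewrite mulr_ge0 ?(ltW d'0) ?(ltW e0).
have p4 : d' * om = 8 * e by rewrite /e; field.
move=> h; suff : e <= 0 by rewrite leNgt e0.
nra.
Qed.

Lemma ratio_cvg (z : nat -> Seq) : (forall n, E (iter n theta x) (z n)) ->
  (forall n, z n 0%N = 0%N) ->
  cvgn (fun n => Ln x n f (z n) / Ln x n one (z n)).
Proof.
move=> Ez z0; apply/cauchy_cvgP/cauchy_exP => e e0.
have [n0 [b [b0 Hb]]] := osc_small (divr_gt0 e0 (ltr0Sn R 1)) 0%N.
have [K Pos] := Hpos.
exists b; exists (maxn n0 K) => // n; rewrite /= geq_max => /andP[n0n Kn].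
have u0 : 0 < Ln x n one (z n) by exact: Pos.
have /andP[h1 h2] : b * Ln x n one (z n) <= Ln x n f (z n) <= (b + e / 2) * Ln x n one (z n).
  by apply: Hb => //; rewrite z0.
rewrite -ler_pdivlMr// in h1; rewrite -ler_pdivrMr// in h2.
rewrite /ball/= ltr_norml; apply/andP; split; lra.
Qed.

End Osc.


(** * Limits along base points: cylinder masses, multiplier, conformality up to distortion *)

Section Limits.
Variable z : X -> Seq.
Hypothesis z_in : forall x, E x (z x).
Hypothesis z_0 : forall x, z x 0%N = 0%N.
Hypothesis W_range : forall a, exists l, forall x w i, E x w -> w i = a -> (w i.+1 <= l)%N.

Definition cylw (s : seq nat) : set Seq := cyl (size s) (nth 0%N s).

(** The integral of f against the normalised image, under the dual of L^n, of the Dirac mass at the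
    base point over theta^n x. Its limit [mean] plays the role of the integral against nu_x. *)
Definition nratio x f n :=
  Ln x n f (z (iter n theta x)) / Ln x n one (z (iter n theta x)).

Definition mean x f := limn (nratio x f).

(** In terms of iterates, this is the integral of L_x 1 against the limit measure over theta x. *)
Definition lam x :=
  limn (fun n => Ln x n.+1 one (z (iter n.+1 theta x)) / Ln (theta x) n one (z (iter n.+1 theta x))).

Lemma nratio_pos : exists K, forall n x, (K <= n)%N -> 0 < Ln x n one (z (iter n theta x)).
Proof.
have [H [H1 HP [K Hpos] HS]] := visit_and_sup.
by exists K => n x Kn; apply: Hpos.
Qed.

Lemma nratio_cvg x f m : bnd f -> (forall v, E x v -> 0 <= f v <= 1) -> dlog x m f ->
  cvgn (nratio x f).
Proof.
move=> bf f01 df; have [H [H1 HP Hpos HS]] := visit_and_sup.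
apply: (ratio_cvg H1 HP Hpos HS bf f01 df) => n; rewrite ?z_0//.
by exists (z (iter n theta x)).
Qed.

Lemma dlog_cylw x s : dlog x (size s) (\1_(cylw s)).
Proof.
move=> D w w' D0 sD _ _ ww'.
have -> : (\1_(cylw s) : Seq -> R) w = (\1_(cylw s) : Seq -> R) w'.
  rewrite !indicE; congr (_ %:R); congr nat_of_bool; apply/idP/idP => /set_mem h.
    by apply/mem_set => i i_s; rewrite (ww' i (leq_trans i_s sD)) h.
  by apply/mem_set => i i_s; rewrite -(ww' i (leq_trans i_s sD)) h.
by rewrite ler_peMl ?ind_ge0// -[leLHS]expR0 ler_expR mulr_ge0 ?exprn_ge0 ?(ltW th_gt0)//
  divr_ge0 ?mulr_ge0 ?subr_ge0 ?(ltW th_gt0) ?(ltW th_lt1).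
Qed.

Lemma cylw_cvg x s : cvgn (nratio x (\1_(cylw s))).
Proof.
apply: (nratio_cvg (m := size s)); [exact: bnd_ind| |exact: dlog_cylw].
by move=> v _; rewrite ind_ge0 indicE lern1 leq_b1.
Qed.

Lemma nratio_ge0 x f n : bnd f -> (forall v, E x v -> 0 <= f v) -> 0 <= nratio x f n.
Proof. by move=> bf f0; rewrite divr_ge0// Ln_ge0//; exact: bnd_cst. Qed.

Lemma mean_ge0 x s : 0 <= mean x (\1_(cylw s)).
Proof.
apply: limr_ge; first exact: cylw_cvg.
by apply: nearW => n; apply: nratio_ge0; [exact: bnd_ind|move=> v _; exact: ind_ge0].
Qed.

Lemma mean_nil x : mean x (\1_(cylw [::])) = 1.
Proof.
have [K HK] := nratio_pos; apply: cvg_lim => //.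
apply: cvg_near_cst; exists K => // n Kn.
rewrite /nratio (_ : \1_(cylw [::]) = one) ?divff ?gt_eqF ?HK//.
by apply/funext => v; rewrite indicE mem_set.
Qed.

Lemma mean_out x s : (forall w, E x w -> ~ cylw s w) -> mean x (\1_(cylw s)) = 0.
Proof.
move=> out; apply: cvg_lim => //; apply: cvg_near_cst; apply: nearW => n.
rewrite /nratio (_ : Ln x n _ _ = 0) ?mul0r//; apply/eqP; rewrite eq_le Ln_ind_ge0// andbT.
apply: (@le_trans _ _ (Ln x n (fun=> 0 * 1) (z (iter n theta x)))).
  apply: Ln_le => //; [exact: bnd_ind|exact/bnd_Z/bnd_cst|].
  by move=> u Eu; rewrite mul0r indicE memNset//; exact: out.
by rewrite Ln_Z ?mul0r//; exact: bnd_cst.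
Qed.

Lemma nratio_split x s l n :
  nratio x (\1_(cylw s)) n = series (fun j => nratio x (\1_(cylw (rcons s j))) n) l.+1 +
     nratio x (\1_(cylw s `&` [set w : Seq | (l < w (size s))%N])) n.
Proof.
have E1 l' : series (fun j => nratio x (\1_(cylw (rcons s j))) n) l' =
    nratio x (\1_(cylw s `&` [set w : Seq | (w (size s) < l')%N])) n.
  elim: l' => [|l' IH].
    rewrite /series/= big_geq// /nratio (_ : Ln x n _ _ = 0) ?mul0r//.
    rewrite (_ : \1_ _ = fun=> 0 * 1); first by rewrite Ln_Z ?mul0r//; exact: bnd_cst.
    by apply/funext => v; rewrite mul0r indicE memNset//= => -[].
  rewrite seriesSr IH /nratio -mulrDl -[Ln _ _ (\1_(_ `&` _)) _]mul1r.
  rewrite -[Ln _ _ (\1_(cylw (rcons _ _))) _]mul1r -Ln_lin; [|exact: bnd_ind|exact: bnd_ind].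
  congr (Ln x n _ _ / _); apply/funext => v; rewrite !mul1r !indicE.
  have [/set_mem [vs]|nv] := boolP (v \in cylw s `&` [set w : Seq | (w (size s) < l'.+1)%N]).
    rewrite /= ltnS leq_eqVlt => /orP[/eqP vl|vl].
      rewrite memNset ?mem_set ?add0r//; last by move=> [_] /=; rewrite vl ltnn.
      move=> i; rewrite size_rcons ltnS nth_rcons leq_eqVlt => /orP[/eqP ->|i_s].
        by rewrite ltnn eqxx.
      by rewrite i_s vs.
    rewrite mem_set ?memNset ?addr0//.
    move=> /(_ (size s)); rewrite size_rcons ltnS leqnn => /(_ isT).
    by rewrite nth_rcons ltnn eqxx => h; rewrite h ltnn in vl.
  rewrite !memNset ?addr0// => [h|h]; move/negP: nv; apply; apply/mem_set; split.
  - by move=> i i_s; rewrite (h i) ?nth_rcons ?i_s// size_rcons leqW.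
  - have := h (size s); rewrite size_rcons leqnn => /(_ isT).
    by rewrite nth_rcons ltnn eqxx => /= ->.
  - by case: h.
  - by case: h => _ /= h; rewrite ltnW.
rewrite E1 /nratio -mulrDl -[Ln _ _ (\1_(_ `&` _)) _]mul1r.
rewrite -[Ln _ _ (\1_(_ `&` [set w : Seq | (l < _)%N])) _]mul1r -Ln_lin; [|exact: bnd_ind|exact: bnd_ind].
congr (Ln x n _ _ / _); apply/funext => v; rewrite !mul1r !indicE !in_setI.
have hm (Q : pred Seq) : (v \in [set w | Q w]) = Q v by apply/idP/idP => [/set_mem|/mem_set].
rewrite (hm (fun w => w (size s) < l.+1)%N) (hm (fun w => l < w (size s))%N).
case: (v \in cylw s) => /=; last by rewrite addr0.
by rewrite ltnS leqNgt; case: (l < _)%N; rewrite /= ?addr0 ?add0r.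
Qed.

(** Tightness, uniform in late n. After a nonempty word the next letter is bounded by [W_range], so
    the tail is empty; only the first letter calls for [tail_bound]. *)
Lemma nratio_tail x s eta : 0 < eta -> exists l0, forall l, (l0 <= l)%N ->
  exists N, forall n, (N <= n)%N ->
  nratio x (\1_(cylw s `&` [set w : Seq | (l < w (size s))%N])) n <= eta.
Proof.
move=> eta0; have [H [H1 HP Hpos HS]] := visit_and_sup.
case/lastP: s => [|s a].
  have H0 : 0 < H by exact: lt_le_trans H1.
  have [K HK] := tail_bound H1 HP 0; have [K' HK'] := nratio_pos.
  have eta'0 : 0 < eta * dA / H by rewrite divr_gt0// mulr_gt0.
  have [l0 Hl0] := W_tail eta'0; exists l0 => l ll; exists (maxn K K') => n.
  rewrite geq_max => /andP[Kn K'n]; rewrite /nratio ler_pdivrMr ?HK'//.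
  have -> : eta = H / dA * (eta * dA / H) by field; rewrite !gt_eqF.
  apply: (le_trans _ (HK _ _ (ltW eta'0) Hl0 _ _ _ Kn _ _)) => //; last by rewrite z_0.
  by apply: Ln_ind_le => // v [_ /=]; exact: leq_ltn_trans.
have [l0 Hl0] := W_range a; exists l0 => l ll; exists 0%N => n _.
apply: le_trans (ltW eta0); rewrite /nratio (_ : Ln x n _ _ = 0) ?mul0r//.
apply/eqP; rewrite eq_le Ln_ind_ge0// andbT.
apply: (@le_trans _ _ (Ln x n (fun=> 0 * 1) (z (iter n theta x)))).
  apply: Ln_le => //; [exact: bnd_ind|exact/bnd_Z/bnd_cst|].
  move=> u Eu; rewrite mul0r indicE memNset// size_rcons => -[us /=].
  apply/negP; rewrite -leqNgt (leq_trans _ ll)//; apply: (Hl0 x) => //.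
  by rewrite us ?size_rcons// nth_rcons ltnn eqxx.
by rewrite Ln_Z ?mul0r//; exact: bnd_cst.
Qed.

(** Limit in n and sum over letters may be exchanged because [nratio_tail] lets no mass escape to
    large letters. *)
Lemma mean_series x s :
  series (fun j => mean x (\1_(cylw (rcons s j)))) @ \oo --> mean x (\1_(cylw s)).
Proof.
have cvs l : (fun n => series (fun j => nratio x (\1_(cylw (rcons s j))) n) l) @ \oo -->
    series (fun j => mean x (\1_(cylw (rcons s j)))) l.
  elim: l => [|l IH].
    by rewrite /series/= big_geq//; under eq_fun do rewrite big_geq//; exact: cvg_cst.
  rewrite seriesSr; under eq_fun do rewrite seriesSr.
  by apply: cvgD; [exact: IH|exact: cylw_cvg].
apply/cvgrPdist_le => e e0; have [l0 Hl0] := nratio_tail x s e0.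
exists l0.+1 => // -[//|l] /=; rewrite ltnS => /Hl0[N HN].
have cd : (fun n => nratio x (\1_(cylw s)) n - series (fun j => nratio x (\1_(cylw (rcons s j))) n) l.+1)
    @ \oo --> mean x (\1_(cylw s)) - series (fun j => mean x (\1_(cylw (rcons s j)))) l.+1.
  by apply: cvgB; [exact: cylw_cvg|exact: cvs].
have dE n : nratio x (\1_(cylw s)) n - series (fun j => nratio x (\1_(cylw (rcons s j))) n) l.+1 =
    nratio x (\1_(cylw s `&` [set w : Seq | (l < w (size s))%N])) n.
  by rewrite (nratio_split x s l n) addrC addKr.
rewrite ger0_norm; last first.
  apply: (cvgr_to_ge cd); apply: nearW => n; rewrite dE.
  by apply: nratio_ge0 => [|v _]; [exact: bnd_ind|exact: ind_ge0].
by apply: (cvgr_to_le cd); exists N => // n Nn; rewrite dE HN.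
Qed.

Lemma L_one_dlog x : dlog (theta x) 0 (fun w => M^-1 * L x one w).
Proof.
move=> D w w' D0 _ Ew Ew' ww'; rewrite mulrCA ler_wpM2l ?invr_ge0 ?(ltW M_gt0)//.
exact: (L_dlog (bnd_cst 1) (fun _ _ => ler01) (@dlog_cst x 1 ler01)).
Qed.

Lemma lam_cvg x : (fun n => Ln x n.+1 one (z (iter n.+1 theta x)) /
    Ln (theta x) n one (z (iter n.+1 theta x))) @ \oo --> lam x.
Proof.
(* Dividing by M brings L_x 1 into [0, 1], the range for which convergence was shown. *)
have c1 : cvgn (nratio (theta x) (fun w => M^-1 * L x one w)).
  apply: (nratio_cvg (m := 0)); [exact/bnd_Z/L_bnd/bnd_cst| |exact: L_one_dlog].
  move=> v Ev; rewrite mulr_ge0 ?invr_ge0 ?(ltW M_gt0)//=.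
    by rewrite ler_pdivrMl// mulr1 L_1le.
  by have := @Ln_ge0 x 1 one v (bnd_cst 1) (fun _ _ => ler01) Ev; rewrite LnS Ln0.
set u := (fun n : nat => _ / _).
have cu : u @ \oo --> M * limn (nratio (theta x) (fun w => M^-1 * L x one w)).
  apply: cvg_trans (cvgMl_tmp (a:=M) c1); apply: near_eq_cvg; apply: nearW => n.
  rewrite /u /nratio -iterSr Ln_Z; last exact/L_bnd/bnd_cst.
  by rewrite -Ln_1 -!mulrA mulVKf// gt_eqF.
by have -> : lam x = M * limn (nratio (theta x) (fun w => M^-1 * L x one w)) by exact: cvg_lim.
Qed.

Lemma lam_bounds : exists c, 0 < c /\ forall x, c <= lam x <= M.
Proof.
have [H [H1 HP Hpos HS]] := visit_and_sup.
have H0 : 0 < H by exact: lt_le_trans H1.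
have [K HK] := Ln_one_succ H1 HP 0; have [K' HK'] := nratio_pos.
exists (dA / H); split=> [|x]; first exact: divr_gt0.
have zE n : E (iter n.+1 theta x) (z (iter n.+1 theta x)) by [].
have HK'x n : (K' <= n)%N -> 0 < Ln (theta x) n one (z (iter n.+1 theta x)).
  by move=> Kn; have := HK' n (theta x) Kn; rewrite -iterSr.
apply/andP; split.
  apply: (cvgr_to_ge (lam_cvg (x := x))); exists (maxn K K') => // n; rewrite /= geq_max => /andP[Kn K'n].
  rewrite ler_pdivlMr ?HK'x// -ler_pdivlMl ?divr_gt0// invf_div.
  by apply: HK => //; rewrite z_0.
apply: (cvgr_to_le (lam_cvg (x := x))); exists K' => // n /= K'n.
rewrite ler_pdivrMr ?HK'x// -Ln_Z; last exact: bnd_cst.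
rewrite Ln_1; apply: Ln_le; [exact/L_bnd/bnd_cst|exact/bnd_Z/bnd_cst| |].
  by move=> v Ev; rewrite mulr1 L_1le.
by rewrite -iterSr.
Qed.

Lemma L_cylw_cons x e s w : L x (\1_(cylw (e :: s))) w =
  W x (scons e w) * (\1_(cylw s) : Seq -> R) w.
Proof.
have lhsE : (fun j => W x (scons j w) * (\1_(cylw (e :: s)) : Seq -> R) (scons j w)) =
    (fun j => if j == e then W x (scons e w) * (\1_(cylw s) : Seq -> R) w else 0).
  apply/funext => j; have [->|je] := eqVneq j e; last first.
    rewrite indicE memNset ?mulr0// => /(_ 0%N isT) /= h.
    by move/eqP: je.
  congr (_ * _); rewrite !indicE; congr (_ %:R); congr nat_of_bool.
  apply/idP/idP => /set_mem h; apply/mem_set.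
    by move=> i i_s; exact: (h i.+1).
  by case=> // i i_s; exact: h.
Transparent L.
rewrite /L; apply: cvg_lim => //.
Opaque L.
apply: cvg_near_cst; exists e.+1 => // n /= en.
rewrite lhsE /series/= (bigD1_seq e) ?mem_index_iota ?iota_uniq//=.
by rewrite eqxx big1 ?addr0// => i /negbTE ->.
Qed.

(** L_x of the indicator of [es] is the weight of e prepended, restricted to [s], and that weight
    varies on [s] by at most the stated factor. The word s is nonempty because [W_dist] needs
    agreement in at least one letter. *)
Lemma jac_le x e s w : s != [::] -> E (theta x) w -> cylw s w ->
  lam x * mean x (\1_(cylw (e :: s))) <= expR (V * th ^+ (size s).+1) *
     (W x (scons e w) * mean (theta x) (\1_(cylw s))) /\
  W x (scons e w) * mean (theta x) (\1_(cylw s)) <= expR (V * th ^+ (size s).+1) *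
    (lam x * mean x (\1_(cylw (e :: s)))).
Proof.
move=> s0 Ew sw; set b := expR _.
have ss : (0 < size s)%N by case: (s) s0.
have [K HK] := nratio_pos.
have HKx n : (K <= n)%N -> 0 < Ln (theta x) n one (z (iter n.+1 theta x)).
  by move=> Kn; have := HK n (theta x) Kn; rewrite -iterSr.
have lhs_cvg : (fun n => Ln (theta x) n (L x (\1_(cylw (e :: s)))) (z (iter n.+1 theta x)) /
    Ln (theta x) n one (z (iter n.+1 theta x))) @ \oo --> lam x * mean x (\1_(cylw (e :: s))).
  have c1 : (fun n => nratio x (\1_(cylw (e :: s))) n.+1) @ \oo --> mean x (\1_(cylw (e :: s))).
    by rewrite (cvg_shiftS (nratio x (\1_(cylw (e :: s))))); exact: cylw_cvg.
  apply: cvg_trans (cvgM (lam_cvg (x := x)) c1); apply: near_eq_cvg; exists K => // n /= Kn.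
  rewrite /nratio -Ln_1 mulrC mulrA divfK// gt_eqF//; apply: HK; exact: leqW.
have rhs_cvg a : (fun n => a * nratio (theta x) (\1_(cylw s)) n) @ \oo -->
    a * mean (theta x) (\1_(cylw s)) by apply: cvgMl_tmp; exact: cylw_cvg.
have Wd v : E (theta x) v -> cylw s v ->
    W x (scons e v) <= b * W x (scons e w) /\ W x (scons e w) <= b * W x (scons e v).
  move=> Ev sv; split; apply: W_dist => //= i i_s; rewrite ?sv ?sw//.
split.
  rewrite mulrA; apply: (ler_cvg_to lhs_cvg (rhs_cvg _)).
  exists K => // n /= Kn; rewrite /nratio -iterSr mulrA ler_wpM2r ?invr_ge0 ?(ltW (HKx _ Kn))//.
  rewrite -Ln_Z; last exact: bnd_ind.
  apply: Ln_le; [exact/L_bnd/bnd_ind|exact/bnd_Z/bnd_ind| |by rewrite -iterSr].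
  move=> v Ev; rewrite L_cylw_cons indicE.
  have [/set_mem vs|_] := boolP (v \in _); last by rewrite !mulr0.
  by rewrite !mulr1; exact: (Wd v Ev vs).1.
have lhs_b := cvgMl_tmp (a:=b) lhs_cvg.
apply: (ler_cvg_to (rhs_cvg _) (lhs_b _)).
exists K => // n /= Kn; rewrite /nratio -iterSr !mulrA ler_wpM2r ?invr_ge0 ?(ltW (HKx _ Kn))//.
rewrite -!Ln_Z; [|exact/L_bnd/bnd_ind|exact: bnd_ind].
apply: Ln_le; [exact/bnd_Z/bnd_ind|exact/bnd_Z/L_bnd/bnd_ind| |by rewrite -iterSr].
move=> v Ev; rewrite L_cylw_cons indicE.
have [/set_mem vs|_] := boolP (v \in _); last by rewrite !mulr0.
by rewrite !mulr1; exact: (Wd v Ev vs).2.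
Qed.

Theorem transfer_limits : exists (p : X -> seq nat -> R) (la : X -> R),
  [/\ (forall x s, nratio x (\1_(cylw s)) @ \oo --> p x s),
      (forall x, (fun n => Ln x n.+1 one (z (iter n.+1 theta x)) /
         Ln (theta x) n one (z (iter n.+1 theta x))) @ \oo --> la x),
      (forall x, [/\ p x [::] = 1, forall s, 0 <= p x s,
         forall s, series (fun j => p x (rcons s j)) @ \oo --> p x s &
         forall s, (forall w, E x w -> ~ cylw s w) -> p x s = 0]),
      (exists c, 0 < c /\ forall x, c <= la x <= M) &
      forall x e s w, s != [::] -> E (theta x) w -> cylw s w ->
        la x * p x (e :: s) <= expR (V * th ^+ (size s).+1) *
          (W x (scons e w) * p (theta x) s) /\
        W x (scons e w) * p (theta x) s <= expR (V * th ^+ (size s).+1) *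
          (la x * p x (e :: s))].
Proof.
exists (fun x s => mean x (\1_(cylw s))), lam; split.
- by move=> x s; exact: cylw_cvg.
- by move=> x; exact: lam_cvg.
- move=> x; split; [exact: mean_nil|exact: mean_ge0| |exact: mean_out].
  by move=> s; exact: mean_series.
- exact: lam_bounds.
- by move=> x e s w; exact: jac_le.
Qed.

End Limits.

End Transfer.

(** * Measures on sequences *)

Lemma measurable_coord (n k : nat) : measurable [set w : Seq | w n = k].
Proof. by apply: sub_sigma_algebra; exists n, k. Qed.

Lemma measurable_Seq d (T : measurableType d) (f : T -> Seq) :
  (forall n k, measurable [set x | f x n = k]) -> measurable_fun setT f.
Proof.
move=> mf; apply: (@measurability _ _ _ _ setT f coord_sets) => //.
move=> _ [_ [n [k ->]] <-]; rewrite setTI; exact: mf.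
Qed.

Lemma cylw_rcons s j (w : Seq) : cylw (rcons s j) w <-> cylw s w /\ w (size s) = j.
Proof.
split=> [h|[sw wj] i].
  split=> [i i_s|].
    by rewrite h ?size_rcons ?leqW// nth_rcons i_s.
  by rewrite h ?size_rcons// nth_rcons ltnn eqxx.
rewrite size_rcons ltnS leq_eqVlt => /orP[/eqP ->|i_s].
  by rewrite nth_rcons ltnn eqxx.
by rewrite nth_rcons i_s sw.
Qed.

Lemma measurable_cylw s : measurable (cylw s).
Proof.
elim/last_ind: s => [|s j IH].
  by rewrite (_ : cylw [::] = setT)//; apply/seteqP; split.
rewrite (_ : cylw _ = cylw s `&` [set w : Seq | w (size s) = j]).
  by apply: measurableI => //; exact: measurable_coord.
by apply/seteqP; split=> w /cylw_rcons.
Qed.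

(* The measure is the image of the uniform distribution on [0, 1[ under the coding
   map of the nested intervals I s of length q s. *)
Section TreeMeasure.
Variables (R : realType) (q : seq nat -> R).
Hypothesis q_nil : q [::] = 1.
Hypothesis q_ge0 : forall s, 0 <= q s.
Hypothesis q_sum : forall s, series (fun j => q (rcons s j)) @ \oo --> q s.

Let part s j : R := series (fun i => q (rcons s i)) j.

Let lft (s : seq nat) : R := \sum_(k < size s) part (take k s) (nth 0%N s k).

Let lft_rcons s j : lft (rcons s j) = lft s + part s j.
Proof.
rewrite /lft size_rcons big_ord_recr/= nth_rcons ltnn eqxx -cats1 take_size_cat//.
congr (_ + _); apply: eq_bigr => i _.
rewrite nth_cat ltn_ord takel_cat//; exact: ltnW.
Qed.

Let part_le s j : part s j <= q s.
Proof.
have cq : cvgn (series (fun i => q (rcons s i))) by apply/cvgP/q_sum.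
rewrite -(cvg_lim _ (q_sum (s := s)))//; apply: nondecreasing_cvgn_le => //.
by apply: nondecreasing_series => *; exact: q_ge0.
Qed.

Let partS s j : part s j.+1 = part s j + q (rcons s j).
Proof. by rewrite /part seriesSr. Qed.

Let part_mono s i j : (i <= j)%N -> part s i <= part s j.
Proof. by move=> ij; apply: nondecreasing_series => // *; exact: q_ge0. Qed.

Let I s : set R := `[lft s, lft s + q s[%classic.

Let IP s u : I s u <-> lft s <= u < lft s + q s.
Proof. by rewrite /I /= in_itv. Qed.

Let I_sub s j u : I (rcons s j) u -> I s u.
Proof.
rewrite !IP lft_rcons => /andP[h1 h2]; apply/andP; split.
  by apply: le_trans h1; rewrite lerDl -{1}(_ : part s 0 = 0) ?part_mono// /part /series/= big_geq.
by apply: lt_le_trans h2 _; rewrite -addrA -partS lerD2l part_le.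
Qed.

Let I_ex s u : I s u -> exists j, u < lft s + part s j.+1.
Proof.
rewrite IP => /andP[_ h].
have e0 : 0 < lft s + q s - u by rewrite subr_gt0.
have /cvgrPdist_lt/(_ _ e0)[n _ /(_ n.+1)] := q_sum (s := s).
move=> /(_ (leqnSn n)) hn; exists n.
rewrite -ltrBlDl; have : q s - part s n.+1 <= `|q s - part s n.+1| by exact: ler_norm.
move: hn; rewrite -/(part s n.+1); lra.
Qed.

(** The index of the child of I s containing u: the children are half-open and adjacent, so it is
    the first one whose right end exceeds u. *)
Let next (u : R) (s : seq nat) : nat :=
  if pselect (exists j, u < lft s + part s j.+1) is left h then ex_minn h else 0%N.

Let next_I s j u : I s u -> (I (rcons s j) u <-> next u s = j).
Proof.
move=> Isu; rewrite /next; case: pselect => [h|/(_ (I_ex Isu))//].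
case: ex_minnP => n hn nmin; rewrite IP lft_rcons -addrA -partS; split=> [/andP[h1 h2]|<-].
  apply/eqP; rewrite eqn_leq nmin//= leqNgt; apply/negP => nj.
  have := lt_le_trans hn (_ : _ <= lft s + part s j).
  by rewrite lerD2l part_mono// => /(_ isT); rewrite ltNge h1.
rewrite hn andbT; case: n hn nmin => [|n] _ nmin.
  rewrite {1}/part /series/= big_geq// addr0.
  by move: Isu; rewrite IP => /andP[].
by rewrite leNgt; apply/negP => /nmin; rewrite ltnn.
Qed.

Let pre (u : R) := fix pre n := if n is k.+1 then rcons (pre k) (next u (pre k)) else [::].

Let pre_size u n : size (pre u n) = n.
Proof. by elim: n => //= n; rewrite size_rcons => ->. Qed.

(** Outside [0, 1[, a null set for the uniform law, the constant sequence 0 is an arbitrary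
    value. *)
Let path (u : R) : Seq := if 0 <= u < 1 then fun n => next u (pre u n) else fun=> 0%N.

Let path_pre u n : 0 <= u < 1 -> cylw (pre u n) (path u).
Proof.
move=> u01; elim: n => [//|n IH] /=; apply/cylw_rcons; split=> //.
by rewrite pre_size /path u01.
Qed.

Let cylw_pre (w : Seq) s s' : size s = size s' -> cylw s w -> cylw s' w -> s = s'.
Proof.
move=> ss sw sw'; apply: (@eq_from_nth _ 0%N) => // i i_s.
by rewrite -sw// sw'// -ss.
Qed.

Let I_nil u : I [::] u <-> 0 <= u < 1.
Proof. by rewrite IP /lft big_ord0 q_nil add0r. Qed.

Let path_cylw u s : 0 <= u < 1 -> (cylw s (path u) <-> I s u).
Proof.
move=> u01; elim/last_ind: s => [|s j IH]; first by split=> // _; exact/I_nil.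
have pathE : cylw s (path u) -> path u (size s) = next u s.
  move=> cs; rewrite /path u01 (@cylw_pre (path u) (pre u (size s)) s) ?pre_size//.
  exact: path_pre.
split=> [/cylw_rcons[cs pj]|Ij].
  by apply/next_I; [exact/IH|rewrite -pathE].
have Is := I_sub Ij; apply/cylw_rcons; split; first exact/IH.
by rewrite pathE; [exact/next_I|exact/IH].
Qed.

Let I_meas s : measurable (I s).
Proof. exact: measurable_itv. Qed.

Let path_meas : measurable_fun setT path.
Proof.
apply: measurable_Seq => n k.
pose U := `[0 : R, 1[%classic.
have mU : measurable U by exact: measurable_itv.
have UP u : U u <-> 0 <= u < 1 by rewrite /U /= in_itv.
rewrite (_ : [set u | path u n = k] =
  (U `&` \bigcup_(s : seq nat) (if size s == n then I (rcons s k) else set0)) `|`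
  (~` U `&` (if k == 0%N then setT else set0))).
  apply: measurableU; apply: measurableI => //.
  - apply: countable_bigcupT_measurable => // s; case: ifP => // _; exact: I_meas.
  - exact: measurableC.
  - by case: ifP => _; [exact: measurableT|exact: measurable0].
apply/seteqP; split=> u /=.
  move=> puk; have [Uu|nUu] := pselect (U u).
    left; split=> //; have u01 := (UP u).1 Uu.
    exists (pre u n) => //; rewrite pre_size eqxx.
    apply/(path_cylw _ u01)/cylw_rcons; rewrite pre_size; split=> //.
    exact: path_pre.
  right; split=> //; move: puk; rewrite /path; case: ifP => [/UP//|_ <-].
  by rewrite eqxx.
case=> [[/UP u01 [s _]]|[nU]].
  case: eqP => // <- /(path_cylw _ u01)/cylw_rcons[_ //].
case: eqP => // -> _; rewrite /path; case: ifP => // /UP; by [].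
Qed.

Lemma tree_measure : exists P : probability Seq R, forall s, P (cylw s) = (q s)%:E.
Proof.

have pm : @measurable_fun _ _ (measurableTypeR R) Seq setT path := path_meas.
pose path' : {mfun measurableTypeR R >-> Seq} :=
  @mfun_Sub _ _ (measurableTypeR R) Seq path (mem_set pm).
pose P0 : probability (measurableTypeR R) R := uniform_prob (@ltr01 R).
have Isub s : I s `<=` `[0, 1[.
  elim/last_ind: s => [|s j IH] u; last by move=> /I_sub/IH.
  by move=> /I_nil; rewrite /= in_itv.
have P0I s : P0 (I s) = (q s)%:E.
  rewrite /P0/= /uniform_prob (eq_integral (fun=> 1%:E)); last first.
    move=> u /set_mem/Isub; rewrite /= in_itv/= /uniform_pdf => /andP[-> /ltW ->].
    by rewrite subr0 invr1.
  rewrite integral_cst//=; last exact: I_meas.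
  rewrite mul1e lebesgue_measure_itv/= lte_fin.
  have [q0|q0] := ltrP 0 (q s); last first.
    by rewrite ltrDl ltNge q0/=; congr (_%:E); apply/eqP; rewrite eq_le q_ge0.
  by rewrite ltrDl q0 -EFinD addrAC subrr add0r.
pose U := `[0 : R, 1[%classic.
have mU : @measurable _ (measurableTypeR R) U by exact: measurable_itv.
have PU : P0 (~` U) = 0%E.
  rewrite probability_setC// (_ : P0 U = 1%E) ?subee//.
  have := P0I [::]; rewrite q_nil => <-; congr (P0 _).
  by apply/seteqP; split=> u; rewrite I_nil /U /= in_itv.
exists (distribution P0 path') => s.
pose A := path' @^-1` cylw s.
have mpre : @measurable _ (measurableTypeR R) A.
  by rewrite -[X in measurable X]setTI; exact: (pm measurableT _ (measurable_cylw s)).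
have PD : P0 (A `\` U) = 0%E.
  apply/eqP; rewrite eq_le measure_ge0 andbT -PU le_measure ?inE//.
  - exact: measurableD.
  - exact: measurableC.
have PE : P0 A = (P0 (A `&` U) + P0 (A `\` U))%E.
  rewrite -measureU ?setUIDK//; [exact: measurableI|exact: measurableD|].
  by apply/seteqP; split=> // u [[_ Uu] [_ /(_ Uu)]].
rewrite /distribution /pushforward -/A -[LHS]/(P0 A) PE PD adde0 -P0I; congr (P0 _).
apply/seteqP; split=> u.
  by move=> [pu]; rewrite /U /= in_itv/= => u01; apply/path_cylw.
move=> Iu; have := Isub _ _ Iu; rewrite /= in_itv/= => u01.
by split; [apply/path_cylw|rewrite /U /= in_itv].
Qed.

End TreeMeasure.

(** * Cylinders as a generating pi-system *)

Definition cyls : set (set Seq) := [set B | B = set0 \/ exists s, B = cylw s].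

Lemma cyls_setI : setI_closed cyls.
Proof.
have key (s s' : seq nat) : (size s <= size s')%N -> cyls (cylw s `&` cylw s').
  move=> ss; have [E|E] := pselect (forall i, (i < size s)%N -> nth 0%N s i = nth 0%N s' i).
    right; exists s'; rewrite setIidr// => w sw i i_s.
    by rewrite (sw i (leq_trans i_s ss)) E.
  left; rewrite -subset0 => w [sw sw']; apply: E => i i_s.
  by rewrite -sw// sw'// (leq_trans i_s).
move=> B C [->|[s ->]]; first by left; rewrite set0I.
move=> [->|[s' ->]]; first by left; rewrite setI0.
have [ss|/ltnW ss] := leqP (size s) (size s'); first exact: key.
by rewrite setIC; exact: key.
Qed.

Lemma cylsT : cyls setT.
Proof. by right; exists [::]; apply/seteqP; split. Qed.

Lemma measurable_cyls : @measurable _ Seq = <<s cyls >>.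
Proof.
apply/seteqP; split; last first.
  apply: smallest_sub; first exact: sigma_algebra_measurable.
  by move=> B [->|[s ->]]; [exact: measurable0|exact: measurable_cylw].
apply: smallest_sub; first exact: smallest_sigma_algebra.
move=> _ [n [k ->]].
rewrite (_ : [set w : Seq | w n = k] = \bigcup_(s : seq nat)
   (if size s == n then cylw (rcons s k) else set0)); last first.
  apply/seteqP; split=> w /=; last first.
    by case=> s _; case: eqP => // <- /cylw_rcons[].
  move=> wn; exists (mkseq w n) => //; rewrite size_mkseq eqxx.
  apply/cylw_rcons; rewrite size_mkseq; split=> // i; rewrite size_mkseq => i_n.
  by rewrite nth_mkseq.
apply: (@countable_bigcupT_measurable _ (g_sigma_algebraType cyls)).
  exact: countableP.
move=> s; case: ifP => _; last exact: measurable0.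
by apply: sub_sigma_algebra; right; exists (rcons s k).
Qed.

Section CylMeasure.
Variable R : realType.
Implicit Types m : {measure set Seq -> \bar R}.

Lemma measure_cyl_succ m s : m (cylw s) = (\sum_(j <oo) m (cylw (rcons s j)))%E.
Proof.
have -> : cylw s = \bigcup_j cylw (rcons s j).
  apply/seteqP; split=> w; first by move=> sw; exists (w (size s)) => //; apply/cylw_rcons.
  by case=> j _ /cylw_rcons[].
rewrite measure_bigcup//=.
- by apply: eq_eseriesl => j; rewrite in_setT.
- by move=> j _; exact: measurable_cylw.
- apply/trivIsetP => i j _ _ /eqP ij; rewrite -subset0 => w.
  by move=> [/cylw_rcons[_ wi] /cylw_rcons[_ wj]]; apply: ij; rewrite -wi -wj.
Qed.

(** A comparison on long cylinders passes to shorter ones, with the same constant, by summing over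
    one-letter extensions. *)
Lemma measure_cyl_le m1 m2 (c : R) n : 0 <= c ->
  (forall s, size s = n -> m1 (cylw s) <= c%:E * m2 (cylw s))%E ->
  forall s, (size s <= n)%N -> (m1 (cylw s) <= c%:E * m2 (cylw s))%E.
Proof.
move=> c0 H s; move: {2}(n - size s)%N (erefl (n - size s)%N) => k.
elim: k s => [|k IH] s ks sn; first by apply: H; lia.
rewrite measure_cyl_succ [in leRHS]measure_cyl_succ -nneseriesZl//.
  apply: lee_nneseries => [j _ _|j _]; first exact: measure_ge0.
apply: IH; rewrite size_rcons; lia.
Qed.

Lemma measure_cyl_eq m1 m2 : (m1 setT < +oo)%E ->
  (forall s, m1 (cylw s) = m2 (cylw s)) -> forall B, measurable B -> m1 B = m2 B.
Proof.
move=> fin H B mB.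
have mB' : <<s cyls >> B by rewrite -measurable_cyls.
apply: (g_sigma_algebra_measure_unique cyls _ (fun=> setT)) => //.
- by move=> C [->|[s ->]]; [exact: measurable0|exact: measurable_cylw].
- by move=> _; exact: cylsT.
- by apply/seteqP; split=> // x _; exists 0%N.
- exact: cyls_setI.
- by move=> C [->|[s ->]]; rewrite ?measure0.
Qed.

End CylMeasure.

(** * Integrating a family of measures *)

Section MixtureMeasure.
Variables (d d' : measure_display) (S : measurableType d) (S' : measurableType d').
Variables (R : realType) (mu : {measure set S -> \bar R}) (D : set S).
Variable k : S -> {measure set S' -> \bar R}.

Definition kernel_meas_on := forall B, measurable B -> measurable_fun D (fun w => k w B).

(** The measurability proofs are arguments so that the measure structure declared below can be
    attached to the term itself. *)
Definition mixture (mD : measurable D) (mk : kernel_meas_on) (B : set S') : \bar R :=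
  (\int[mu]_(w in D) k w B)%E.

Hypotheses (mD : measurable D) (mk : kernel_meas_on).

Let mixture0 : mixture mD mk set0 = 0%E.
Proof. by rewrite /mixture integral0_eq// => w _; rewrite measure0. Qed.

Let mixture_ge0 B : (0 <= mixture mD mk B)%E.
Proof. by apply: integral_ge0 => w _; exact: measure_ge0. Qed.

Let mixture_sigma_additive : semi_sigma_additive (mixture mD mk).
Proof.
move=> F mF tF mUF; rewrite /mixture.
rewrite [X in _ --> X](_ : _ = (\sum_(i <oo) \int[mu]_(w in D) k w (F i))%E).
  apply: is_cvg_nneseries => i _ _; apply: integral_ge0 => w _; exact: measure_ge0.
rewrite -integral_nneseries//; last by move=> n; exact: mk.
apply: eq_integral => w _; rewrite measure_bigcup//=.
by apply: eq_eseriesl => j; rewrite in_setT.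
Qed.

HB.instance Definition _ := isMeasure.Build _ _ _ (mixture mD mk)
  mixture0 mixture_ge0 mixture_sigma_additive.

End MixtureMeasure.

(** * The random shift *)

Section Concrete.
Context (d : measure_display) (T : measurableType d) (R : realType).
Variables (m : probability T R) (theta : T -> T) (A : T -> nat -> nat -> bool).
Variables (phi : T -> Seq -> R) (alpha : R).

(** * Measurable selection of admissible sequences *)

Section Selection.
Hypothesis mixing : top_mixing theta A.

Lemma successor x a : exists j, A x a j.
Proof.
have [N /(_ N (leqnn N) x)[w [w0 _ /(_ 0%N isT)]]] := mixing a a.
by rewrite /= w0; exists (w 1%N).
Qed.

(* The path from 0 that always takes the least admissible successor: an explicit
   choice, so that it depends measurably on x. *)
Fixpoint least_path (x : T) (i : nat) : nat :=
  if i is k.+1 then ex_minn (successor (iter k theta x) (least_path x k)) else 0%N.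

Definition base_point (x : T) : Seq := least_path x.

Lemma base_point_in x : Einf theta A x (base_point x).
Proof. by move=> i; rewrite /base_point /=; case: ex_minnP. Qed.

Hypothesis theta_meas : measurable_fun setT theta.
Hypothesis A_meas : A_measurable A.

Lemma iter_meas n : measurable_fun setT (iter n theta).
Proof.
elim: n => [|n IH]; first exact: measurable_id.
exact: (measurableT_comp theta_meas IH).
Qed.

Lemma edge_meas n a b : measurable [set x | A (iter n theta x) a b].
Proof.
have := measurableT_comp (A_meas a b) (iter_meas n).
move=> /(_ measurableT [set true]); rewrite setTI; apply.
by [].

Qed.

Lemma base_point_meas : measurable_fun setT base_point.
Proof.
apply: measurable_Seq => n; elim: n => [|n IH] k.
  by have [->|k0] := eqVneq k 0%N;
    [rewrite (_ : [set x | _] = setT)//|rewrite (_ : [set x | _] = set0)//];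
    apply/seteqP; split=> // x /= /eqP; rewrite eq_sym (negbTE k0).
rewrite (_ : [set x | _] = \bigcup_a ([set x | base_point x n = a] `&`
   ([set x | A (iter n theta x) a k] `\` \bigcup_(j in `I_k) [set x | A (iter n theta x) a j]))).
  apply: bigcupT_measurable => a; apply: measurableI; first exact: IH.
  apply: measurableD; first exact: edge_meas.
  by apply: bigcup_measurable => j _; exact: edge_meas.
apply/seteqP; split=> x /=.
  move=> xk; exists (base_point x n) => //; split=> //.
  move: xk; rewrite /base_point/=; case: ex_minnP => k' h1 h2 <-; split=> // -[j /= jk h].
  by have := h2 j h; rewrite leqNgt jk.
case=> a _ [<- [h1 h2]]; rewrite /base_point/=; case: ex_minnP => k' g1 g2.
apply/eqP; rewrite eqn_leq g2//= leqNgt; apply/negP => kk; apply: h2.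
by exists k'.
Qed.

End Selection.

(** The almost sure hypotheses read at one point, with all constants fixed outside. They amount to
    countably many conditions, so one null set suffices; to this end the tail limit is encoded by
    cutoffs [l_ k] with tail at most 1 / (k + 1). *)
Definition good (V : R) (cC : nat -> R * R) (D : nat -> seq nat) (l_ : nat -> nat) (M0 : R)
    (x : T) : Prop :=
  [/\ forall t w, Einf theta A x t -> Einf theta A x w -> t <> w -> t 0%N = w 0%N ->
        `|phi x t - phi x w| <= V * (dist t w) `^ alpha,
      forall e w, cylF theta A [set e] x w -> (cC e).1 <= expR (phi x w) <= (cC e).2,
      forall e j, A x e j -> j \in D e,
      forall k w, Einf theta A (theta x) w ->
        (Lop A phi x (ind (Einf theta A x `\` cylF theta A [set e | (e <= l_ k)%N] x)) w
         <= (k.+1%:R^-1 : R)%:E)%E &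
      forall w, cylF theta A [set 0%N] (theta x) w -> (M0^-1%:E <= Lop A phi x (@Defs.one R) w)%E].

Lemma good_exists : fine_pair theta A phi m alpha -> finite_range m A ->
  exists V cC D l_ M0, [/\ 0 <= V, forall e, 0 < (cC e).1, 0 < M0 &
    \forall x \ae m, good V cC D l_ M0 x].
Proof.
move=> [[_ _ Vfin cCP tail] condA _ _] /choice[D HD].
have [V [V0 HV]] : exists V : R, 0 <= V /\ \forall x \ae m,
    (v_alpha alpha (Einf theta A x) (phi x) <= V%:E)%E.
  have := ess_sup_ge m (fun x => v_alpha alpha (Einf theta A x) (phi x)).
  move: Vfin; case: (ess_sup m _) => [r _ H| //|_ H].
  - exists (Num.max 0 r); split; first by rewrite le_max lexx.
    by apply: filterS H => x h; apply: (le_trans h); rewrite lee_fin le_max lexx orbT.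
  (* The value -oo has to be treated since [v_alpha] is a supremum over a possibly empty set. *)
  - by exists 0; split=> //; apply: filterS H => x h; apply: (le_trans h); exact: leNye.
have /choice[cC HcC] : forall e, exists cC : R * R, 0 < cC.1 /\
    \forall x \ae m, forall w, cylF theta A [set e] x w ->
      cC.1 <= expR (phi x w) <= cC.2.
  by move=> e; have [c [C [c0 cC H]]] := cCP e; exists (c, C).
have /choice[l_ Hl] : forall k, exists l, \forall x \ae m,
   forall w, Einf theta A (theta x) w ->
        (Lop A phi x (ind (Einf theta A x `\` cylF theta A [set e | (e <= l)%N] x)) w
         <= (k.+1%:R^-1 : R)%:E)%E.
  move=> k; move/fine_cvgP: tail => -[ffin /cvgrPdist_lt/(_ (k.+1%:R^-1))].
  rewrite invr_gt0 ltr0Sn => /(_ isT) fcvg.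
  have [l [lfin llt]] : exists l, (ess_sup m (fun x =>
          ereal_sup [set Lop A phi x (ind (Einf theta A x `\` cylF theta A [set e | (e <= l)%N] x)) w
                    | w in Einf theta A (theta x)]) \is a fin_num) /\
     `|0 - fine (ess_sup m (fun x =>
          ereal_sup [set Lop A phi x (ind (Einf theta A x `\` cylF theta A [set e | (e <= l)%N] x)) w
                    | w in Einf theta A (theta x)]))| < k.+1%:R^-1.
    have [l hl] := @filter_ex _ \oo _ _ (filterI ffin fcvg).
    by exists l; case: hl.
  exists l; have := ess_sup_ge m (fun x =>
          ereal_sup [set Lop A phi x (ind (Einf theta A x `\` cylF theta A [set e | (e <= l)%N] x)) w
                    | w in Einf theta A (theta x)]).
  apply: filterS => x hx w Ew.
  apply: (@le_trans _ _ (ereal_sup [set Lop A phi x (ind (Einf theta A x `\` cylF theta A [set e | (e <= l)%N] x)) w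
                    | w in Einf theta A (theta x)])).
    by apply: ereal_sup_ubound; exists w.
  apply: (le_trans hx); rewrite -(fineK lfin) lee_fin.
  by move: llt; rewrite sub0r normrN; move/ltW; apply: le_trans; exact: ler_norm.
have [M0 [M00 HM0]] := condA 0%N.
exists V, cC, D, l_, M0; split=> //; first by move=> e; case: (HcC e).
have a2 : \forall x \ae m, forall e w, cylF theta A [set e] x w ->
      (cC e).1 <= expR (phi x w) <= (cC e).2.
  by apply/ae_foralln => e; case: (HcC e).
have a3 : \forall x \ae m, forall e j, A x e j -> j \in D e by exact/ae_foralln.
have a4 := ae_foralln Hl.
near=> x; split.
- move=> t w Et Ew tw tw0.
  have h : (v_alpha alpha (Einf theta A x) (phi x) <= V%:E)%E by near: x.
  have dpos : 0 < dist t w `^ alpha.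
    apply: powR_gt0; rewrite /dist; case: pselect => [k|k]; first exact: expR_gt0.
    exfalso; apply: tw; apply/funext => i; apply: contrapT => ti; apply: k.
    by exists i; apply/eqP => wi; apply: ti.
  rewrite -ler_pdivrMr// -lee_fin; apply: le_trans h.
  by apply: ereal_sup_ubound; exists t, w.
- by near: x.
- by near: x.
- by near: x.
- by near: x.
Unshelve. all: by end_near. Qed.


Lemma Einf_scons x e w :
  Einf theta A x (scons e w) <-> A x e (w 0%N) /\ Einf theta A (theta x) w.
Proof.
split=> [h|[h0 h] [|i]] //.
- split; first exact: (h 0%N).
  by move=> i; have := h i.+1; rewrite iterSr.
- by have := h i; rewrite -iterSr.
Qed.

(** * The good set and the weights on it *)

Section GoodSet.
Variables (V : R) (cC : nat -> R * R) (D : nat -> seq nat) (l_ : nat -> nat) (M0 : R).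
Hypothesis m_complete : measure_is_complete m.
Hypothesis theta_meas : measurable_fun setT theta.
Hypothesis theta_pres : measure_preserving m theta.
Hypothesis good_ae : \forall x \ae m, good V cC D l_ M0 x.

(** The iterates at x involve the weights at all forward images of x, so goodness is required along
    the whole forward orbit. *)
Definition good_set : set T := [set x | forall j, good V cC D l_ M0 (iter j theta x)].

Lemma ae_theta (P : T -> Prop) : (\forall x \ae m, P x) -> \forall x \ae m, P (theta x).
Proof.
move=> [B [mB B0 PB]]; exists (theta @^-1` B); split.
- by rewrite -[X in measurable X]setTI; exact: theta_meas.
- by rewrite theta_pres.
- by move=> x; exact: PB.
Qed.

Lemma good_set_ae : \forall x \ae m, good_set x.
Proof.
apply/ae_foralln => j; elim: j => [//|j IH].
by apply: filterS (ae_theta IH) => x; rewrite iterSr.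
Qed.

(** Completeness of m enters here: the complement is only known to be negligible. *)
Lemma good_set_meas : measurable good_set.
Proof. by rewrite -[good_set]setCK; apply: measurableC; apply: m_complete; exact: good_set_ae. Qed.

Lemma good_set_theta x : good_set x -> good_set (theta x).
Proof. by move=> Gx j; rewrite -iterSr; exact: Gx. Qed.

Lemma good_set_good x : good_set x -> good V cC D l_ M0 x.
Proof. by move=> /(_ 0%N). Qed.

Definition weight_dom : set (T * Seq) := Omega theta A `&` (good_set `*` setT).

(** The potential is controlled only on [Omega] and over good points. Extension by 0 makes the sum
    bound hold everywhere and the weight jointly measurable on the whole product. *)
Definition weight (x : T) (w : Seq) : R :=
  if (x, w) \in weight_dom then expR (phi x w) else 0.

Lemma weight_ge0 x w : 0 <= weight x w.
Proof. by rewrite /weight; case: ifP => // _; exact: expR_ge0. Qed.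

Lemma weight_in x w : good_set x -> Einf theta A x w -> weight x w = expR (phi x w).
Proof. by move=> Gx Ew; rewrite /weight mem_set. Qed.

Lemma weight_out x w : ~ Einf theta A x w -> weight x w = 0.
Proof. by move=> nE; rewrite /weight memNset// => -[]. Qed.

Lemma weight_bad x w : ~ good_set x -> weight x w = 0.
Proof. by move=> nG; rewrite /weight memNset// => -[_ []]. Qed.

Lemma Lop_weight x w (g : Seq -> \bar R) (h : Seq -> R) : good_set x ->
  Einf theta A (theta x) w -> (forall v, Einf theta A x v -> g v = (h v)%:E) ->
  Lop A phi x g w = (\sum_(0 <= e <oo) (weight x (scons e w) * h (scons e w))%:E)%E.
Proof.
move=> Gx Ew gh; apply: eq_eseriesr => e _.
have [Ae|nA] := boolP (A x e (w 0%N)).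
  have Es : Einf theta A x (scons e w) by apply/Einf_scons.
  by rewrite gh// weight_in// -EFinM mulrC.
by rewrite weight_out ?mul0r// => /Einf_scons[]; rewrite (negbTE nA).
Qed.

Hypothesis cC_gt0 : forall e, 0 < (cC e).1.

Lemma tail_partial x k w n : good_set x ->
  series (fun e => weight x (scons e w) * (\1_(above (l_ k)) : Seq -> R) (scons e w)) n
    <= k.+1%:R^-1.
Proof.
move=> Gx; have [Ew|nE] := pselect (Einf theta A (theta x) w); last first.
  rewrite /series/= big1 ?invr_ge0// => e _.
  by rewrite weight_out ?mul0r// => /Einf_scons[].
have [_ _ _ /(_ k w Ew) h _] := good_set_good Gx.
rewrite -lee_fin; apply: le_trans h.
rewrite (@Lop_weight x w _ (\1_(above (l_ k))))//; last first.
  move=> v Ev; rewrite /ind; congr (_%:E); rewrite !indicE; congr (_ %:R); congr nat_of_bool.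
  apply/idP/idP => /set_mem.
    move=> [_ h]; apply/mem_set; rewrite /above/= ltnNge; apply/negP => vl; apply: h.
    by split.
  rewrite /above /= => h; apply/mem_set; split=> // -[_ /=].
  by rewrite leqNgt h.
rewrite /series/= -sumEFin; apply: nneseries_lim_ge => i _ _.
by rewrite lee_fin mulr_ge0 ?weight_ge0 ?ind_ge0.
Qed.

(** Letters above [l_ 0] contribute at most 1, the case k = 0 of the tail bound, and each other
    letter at most its C_e; the maximum with 0 supplies the sign of these constants. *)
Definition weight_bound : R := 1 + \sum_(0 <= e < (l_ 0).+1) Num.max 0 (cC e).2.

Lemma weight_bound_gt0 : 0 < weight_bound.
Proof. by rewrite ltr_pwDl// sumr_ge0// => e _; rewrite le_max lexx. Qed.

Lemma weight_sum x w n : series (fun e => weight x (scons e w)) n <= weight_bound.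
Proof.
have [Gx|nG] := pselect (good_set x); last first.
  by rewrite /series/= big1 ?(ltW weight_bound_gt0)// => e _; rewrite weight_bad.
pose c e := if (e < (l_ 0).+1)%N then Num.max 0 (cC e).2 else 0.
have c0 e : 0 <= c e by rewrite /c; case: ifP => // _; rewrite le_max lexx.
have step e : weight x (scons e w) <=
    weight x (scons e w) * (\1_(above (l_ 0)) : Seq -> R) (scons e w) + c e.
  rewrite indicE; have [/set_mem ab|/negP ab] := boolP (scons e w \in _).
    by rewrite mulr1 lerDl.
  rewrite mulr0 add0r /c ltnS leqNgt ifT; last first.
    by apply/negP => h; apply: ab; apply/mem_set.
  have [Es|nE] := pselect (Einf theta A x (scons e w)); last first.
    by rewrite weight_out// le_max lexx.
  have [_ /(_ e (scons e w)) h _ _ _] := good_set_good Gx.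
  by rewrite weight_in// le_max; have /andP[_ ->] := h (conj Es erefl); rewrite orbT.
rewrite /series/= (le_trans (ler_sum _ (fun e _ => step e)))// big_split/=.
apply: lerD; first by have := tail_partial 0 w n Gx; rewrite invr1.
have cs k : ((l_ 0).+1 <= k)%N -> \sum_(0 <= e < k) c e = \sum_(0 <= e < (l_ 0).+1) Num.max 0 (cC e).2.
  move=> lk; rewrite (big_cat_nat (leq0n _) lk)//=.
  rewrite (_ : \sum_((l_ 0).+1 <= e < k) c e = 0) ?addr0.
    by apply: eq_big_nat => e /andP[_ el]; rewrite /c el.
  by rewrite big_nat big1// => e /andP[le _]; rewrite /c ltnNge le.
have [nl|/ltnW ln] := leqP n (l_ 0).+1; last by rewrite cs.
rewrite -(cs (l_ 0).+1)// (big_cat_nat (leq0n _) nl)//= lerDl.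
by apply: sumr_ge0.
Qed.

Lemma weight_dist x e D' w w' : 0 <= V -> good_set x -> (0 < D')%N ->
  Einf theta A (theta x) w -> Einf theta A (theta x) w' -> agree D' w w' ->
  0 < alpha ->
  weight x (scons e w) <= expR (V * expR (- alpha) ^+ D'.+1) * weight x (scons e w').
Proof.
move=> V0 Gx D0 Ew Ew' ww' a0.
have [Es|nE] := pselect (Einf theta A x (scons e w)); last first.
  by rewrite weight_out// mulr_ge0 ?expR_ge0 ?weight_ge0.
have Es' : Einf theta A x (scons e w').
  move/Einf_scons: (Es) => [Ae _]; apply/Einf_scons; split=> //.
  by rewrite (ww' 0%N D0).
rewrite !weight_in// -expRD ler_expR -lerBlDr.
have [E|ne] := pselect (scons e w = scons e w').
  by rewrite E subrr mulr_ge0 ?exprn_ge0 ?expR_ge0.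
have [H _ _ _ _] := good_set_good Gx.
apply: (le_trans (ler_norm _)); apply: (le_trans (H _ _ Es Es' ne erefl)).
rewrite ler_wpM2l// /dist; case: pselect => [k|nk]; last first.
  by rewrite powR0 ?exprn_ge0 ?expR_ge0// gt_eqF.
case: ex_minnP => n hn _.
(* The common letter e in front shifts the first disagreement by one; with th = exp(-alpha) the
   Hölder bound becomes V th^(D'+1). *)
have Dn : (D'.+1 <= n)%N.
  rewrite ltnNge; apply/negP => nD; move/negP: hn; apply; apply/eqP.
  by case: n nD => // n nD; rewrite /= (ww' n).
rewrite -expRM -expRM_natl ler_expR mulNr mulrN lerN2 ler_wpM2r ?(ltW a0)//.
by rewrite ler_nat.
Qed.

Local Notation TL := (L weight).
Local Notation TLn := (Ln theta weight).

Lemma nneseries_real (u : nat -> R) : cvgn (series u) ->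
  (\sum_(0 <= e <oo) (u e)%:E)%E = (limn (series u))%:E.
Proof.
move=> cu; rewrite -EFin_lim//; congr (limn _); apply/funext => n.
by rewrite /series /= -sumEFin.
Qed.

Lemma Lop_real x w (g : Seq -> \bar R) (h : Seq -> R) : bnd h -> good_set x ->
  Einf theta A (theta x) w -> (forall v, Einf theta A x v -> g v = (h v)%:E) ->
  Lop A phi x g w = (TL x h w)%:E.
Proof.
move=> bh Gx Ew gh; rewrite (Lop_weight Gx Ew gh) nneseries_real//.
exact: (L_cvg weight_ge0 weight_sum).
Qed.

Lemma weight_tail eta : 0 < eta ->
  exists l, forall x w, good_set x -> TL x (\1_(above l)) w <= eta.
Proof.
move=> eta0; have [k _ /(_ k (leqnn k)) /ltW ke] := near_infty_natSinv_lt (PosNum eta0).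
exists (l_ k) => x w Gx; apply: le_trans ke.
apply: limr_le; first exact: (L_cvg weight_ge0 weight_sum (bnd_ind R _)).
by apply: nearW => n; exact: tail_partial.
Qed.

Lemma weight_low x w : good_set x -> Einf theta A (theta x) w -> w 0%N = 0%N ->
  M0^-1 <= TL x (fun=> 1) w.
Proof.
move=> Gx Ew w0; have [_ _ _ _ h] := good_set_good Gx.
rewrite -lee_fin -(@Lop_real x w (@Defs.one R))//; last exact: bnd_cst.
exact: h.
Qed.

Lemma L_ge_term x e w g : bnd g -> (forall v, Einf theta A x v -> 0 <= g v) ->
  weight x (scons e w) * g (scons e w) <= TL x g w.
Proof.
move=> bg g0.
have t0 j : 0 <= weight x (scons j w) * g (scons j w).
  have [Es|nE] := pselect (Einf theta A x (scons j w)); last by rewrite weight_out ?mul0r.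
  by rewrite mulr_ge0 ?weight_ge0 ?g0.
have cv := L_cvg weight_ge0 weight_sum (x := x) (w := w) bg.
apply: (@le_trans _ _ (series (fun e => weight x (scons e w) * g (scons e w)) e.+1)).
  by rewrite seriesSr lerDr sumr_ge0.
by apply: nondecreasing_cvgn_le => //; apply: nondecreasing_series.
Qed.

Lemma good_set_iter n x : good_set x -> good_set (iter n theta x).
Proof. by move=> Gx; elim: n => //= n; exact: good_set_theta. Qed.

(** All terms being nonnegative, L^n dominates the contribution of the single word v; g is evaluated
    at the first k letters of v followed by w. *)
Lemma Ln_path k x (w : Seq) (v : nat -> nat) g : good_set x -> bnd g ->
  (forall u, Einf theta A x u -> 0 <= g u) ->
  adm_word theta A x k v -> v k = w 0%N -> Einf theta A (iter k theta x) w ->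
  \prod_(i < k) (cC (v i)).1 * g (fun i => if (i < k)%N then v i else w (i - k)%N)
    <= TLn x k g w.
Proof.
move=> Gx bg g0; elim: k w => [|k IH] w av vk Ew.
  by rewrite big_ord0 mul1r (_ : (fun i => _) = w)//; apply/funext => i; rewrite subn0.
have Es : Einf theta A (iter k theta x) (scons (v k) w).
  by apply/Einf_scons; split=> //; rewrite -vk; exact: (av k (leqnn _)).
have bLn : bnd (TLn x k g) by exact: (Ln_bnd theta weight_ge0 weight_sum weight_out).
rewrite LnS.
apply: le_trans (L_ge_term _ _ bLn _); last first.
  by move=> u Eu; exact: (Ln_ge0 weight_ge0 weight_sum weight_out).
rewrite big_ord_recr/= mulrAC mulrC; apply: ler_pM => //.
- exact: ltW.
- rewrite mulr_ge0 ?prodr_ge0// => [i _|]; first exact: ltW.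
  apply: g0 => i.
  case: (ltnP i.+1 k.+1) => ik.
    by rewrite ltnS in ik; rewrite ltnS (ltnW ik); apply: av; rewrite ltnS ltnW.
  rewrite ltnS in ik; case: (ltnP i k.+1) => ik'.
    have <- : k = i by apply/eqP; rewrite eqn_leq ik.
    by rewrite subnn -vk; exact: (av k (leqnn _)).
  have := Ew (i - k.+1)%N; rewrite -iterD subnK// subSn//.
- rewrite weight_in//; last exact: good_set_iter.
  have [_ /(_ (v k) (scons (v k) w)) h _ _ _] := good_set_good (good_set_iter k Gx).
  by have /andP[] := h (conj Es erefl).
- have := IH (scons (v k) w) (fun i ik => av i (ltnW ik)) erefl Es.
  congr (_ * g _ <= _); apply/funext => i.
  case: (ltnP i k) => ik; first by rewrite ltnW.
  case: (ltnP i k.+1) => ik'.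
    have -> : i = k by apply/eqP; rewrite eqn_leq ik -ltnS ik'.
    by rewrite subnn.
  by have -> : (i - k)%N = (i - k.+1).+1 by rewrite subnSK.
Qed.

(** By finite range only finitely many letters can be reached from a in i steps, whatever the point
    x; a minimum over these at each step bounds all paths at once. *)
Lemma path_weight a k : exists c, 0 < c /\ forall x v, good_set x ->
  adm_word theta A x k v -> v 0%N = a -> c <= \prod_(i < k) (cC (v i)).1.
Proof.
have fin (s : seq nat) : exists c, 0 < c /\ forall e, e \in s -> c <= (cC e).1.
  elim: s => [|e s [c [c0 IH]]]; first by exists 1.
  exists (Num.min c (cC e).1); split; first by rewrite lt_min c0 cC_gt0.
  move=> e'; rewrite inE => /orP[/eqP ->|es]; rewrite ge_min ?lexx ?orbT//.
  by rewrite IH.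
pose Dn := fix Dn i := if i is j.+1 then flatten [seq D e | e <- Dn j] else [:: a].
have vD x v n : good_set x -> adm_word theta A x n v -> v 0%N = a ->
    forall i, (i <= n)%N -> v i \in Dn i.
  move=> Gx av va; elim=> [_|i IH iN]; first by rewrite /= va inE.
  apply/flattenP; exists (D (v i)); first by apply: map_f; exact/IH/ltnW.
  have [_ _ h _ _] := good_set_good (good_set_iter i Gx).
  by apply: h; exact: av.
elim: k => [|k [c [c0 IH]]]; first by exists 1; split=> // *; rewrite big_ord0.
have [c' [c'0 Hc']] := fin (Dn k).
exists (c * c'); split=> [|x v Gx av va]; first exact: mulr_gt0.
rewrite big_ord_recr/=; apply: ler_pM; rewrite ?(ltW c0) ?(ltW c'0)//.
  by apply: (IH x) => // i ik; apply: av; exact: ltnW.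
by apply: Hc'; exact: (vD x v k.+1).
Qed.

Lemma weight_mix a b : top_mixing theta A -> exists N, forall k, (N <= k)%N ->
  exists c : R, 0 < c /\ forall x, good_set x -> exists v : Seq, v 0%N = a /\
    forall w, Einf theta A (iter k theta x) w -> w 0%N = b ->
      c <= TLn x k (\1_(cyl k v)) w.
Proof.
(* A word of length n + 1 between a and b makes a path of n + 2 steps. *)
move=> /(_ a b)[N HN]; exists N.+2 => -[//|[//|k]]; rewrite !ltnS => Nk.
have [c [c0 Hc]] := path_weight a k.+2.
exists c; split=> // x Gx; have [v [va vb av]] := HN k Nk x.
exists v; split=> // w Ew wb; apply: (le_trans (Hc x v Gx av va)).
have := @Ln_path k.+2 x w v (\1_(cyl k.+2 v) : Seq -> R) Gx (bnd_ind R _) (fun u _ => ind_ge0 R _ u) av.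
rewrite vb => /(_ (esym wb) Ew); apply: le_trans.
by rewrite indicE mem_set ?mulr1// => i ik; rewrite ik.
Qed.

Lemma weight_range a : exists l, forall x w i, good_set x -> Einf theta A x w ->
  w i = a -> (w i.+1 <= l)%N.
Proof.
exists (\max_(e <- D a) e) => x w i Gx Ew wi.
have [_ _ h _ _] := good_set_good (good_set_iter i Gx).
have /h : A (iter i theta x) a (w i.+1) by rewrite -wi.
by move=> wD; exact: (leq_bigmax_seq (F := id)).
Qed.

Hypothesis V_ge0 : 0 <= V.
Hypothesis M0_gt0 : 0 < M0.
Hypothesis alpha_gt0 : 0 < alpha.
Hypothesis mixing : top_mixing theta A.

Local Notation z := (base_point mixing).

Definition cyl_ratio x s n : R :=
  TLn x n (\1_(cylw s)) (z (iter n theta x)) / TLn x n (fun=> 1) (z (iter n theta x)).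

Definition mass_ratio x n : R := TLn x n.+1 (fun=> 1) (z (iter n.+1 theta x)) /
  TLn (theta x) n (fun=> 1) (z (iter n.+1 theta x)).

Definition cyl_mass x s : R := limn (cyl_ratio x s).

Definition eigval x : R := limn (mass_ratio x).

(* The convergence theorem needs its hypotheses at all points, hence is applied to
   the type of good points. *)
Let X := {x : T | good_set x}.

Let thX (xx : X) : X := exist _ (theta (sval xx)) (good_set_theta (svalP xx)).

Let iterX n xx : sval (iter n thX xx) = iter n theta (sval xx).
Proof. by elim: n => //= n ->. Qed.

Let LnX n xx g : Ln thX (fun yy : X => weight (sval yy)) xx n g = TLn (sval xx) n g.
Proof. by elim: n => //= n ->; rewrite /L iterX. Qed.

Lemma limits : [/\ (forall x s, good_set x -> cyl_ratio x s @ \oo --> cyl_mass x s),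
  (forall x, good_set x -> mass_ratio x @ \oo --> eigval x),
  (forall x, good_set x -> [/\ cyl_mass x [::] = 1, forall s, 0 <= cyl_mass x s,
      forall s, series (fun j => cyl_mass x (rcons s j)) @ \oo --> cyl_mass x s &
      forall s, (forall w, Einf theta A x w -> ~ cylw s w) -> cyl_mass x s = 0]),
  (exists c, 0 < c /\ forall x, good_set x -> c <= eigval x <= weight_bound) &
  forall x e s w, good_set x -> s != [::] -> Einf theta A (theta x) w -> cylw s w ->
    eigval x * cyl_mass x (e :: s) <= expR (V * expR (- alpha) ^+ (size s).+1) *
      (weight x (scons e w) * cyl_mass (theta x) s) /\
    weight x (scons e w) * cyl_mass (theta x) s <= expR (V * expR (- alpha) ^+ (size s).+1) *
      (eigval x * cyl_mass x (e :: s))].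
Proof.
have th1 : expR (- alpha) < 1 by rewrite expR_lt1 oppr_lt0.
have M0' : 0 < M0^-1 by rewrite invr_gt0.
have := @transfer_limits R X thX (fun xx => Einf theta A (sval xx))
  (fun xx => weight (sval xx)) weight_bound weight_bound_gt0
  (fun xx => weight_ge0 (sval xx)) (fun xx => weight_sum (sval xx))
  (fun xx => @weight_out (sval xx)) V (expR (- alpha)) M0^-1 V_ge0 (expR_gt0 _) th1 M0'.
have dist xx e D' w w' : (0 < D')%N -> Einf theta A (sval (thX xx)) w ->
    Einf theta A (sval (thX xx)) w' -> agree D' w w' ->
    weight (sval xx) (scons e w) <=
    expR (V * expR (- alpha) ^+ D'.+1) * weight (sval xx) (scons e w').
  by move=> D0 Ew Ew' ww'; exact: (weight_dist e V_ge0 (svalP xx) D0 Ew Ew' ww' alpha_gt0).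
move=> /(_ dist).
have tail (eta : R) : 0 < eta -> exists l, forall (xx : X) w,
    L (fun xx : X => weight (sval xx)) xx (\1_(above l)) w <= eta.
  by move=> /weight_tail[l Hl]; exists l => xx w; exact: (Hl _ _ (svalP xx)).
move=> /(_ tail).
have mix a b : exists N, forall k, (N <= k)%N -> exists c : R, 0 < c /\
    forall xx : X, exists v : Seq, v 0%N = a /\ forall w,
      Einf theta A (sval (iter k thX xx)) w -> w 0%N = b ->
      c <= Ln thX (fun yy : X => weight (sval yy)) xx k (\1_(cyl k v)) w.
  have [N HN] := weight_mix a b mixing; exists N => k /HN[c [c0 Hc]].
  exists c; split=> // xx; have [v [va Hv]] := Hc _ (svalP xx).
  by exists v; split=> // w; rewrite iterX LnX; exact: Hv.
move=> /(_ mix).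
have low (xx : X) w : Einf theta A (sval (thX xx)) w -> w 0%N = 0%N ->
    M0^-1 <= L (fun xx : X => weight (sval xx)) xx (fun=> 1) w.
  by move=> Ew w0; exact: (weight_low (svalP xx) Ew w0).
move=> /(_ low (fun xx => z (sval xx))).
move=> /(_ (fun xx => base_point_in mixing (sval xx)) (fun=> erefl)).
have range a : exists l, forall (xx : X) w i, Einf theta A (sval xx) w -> w i = a ->
    (w i.+1 <= l)%N.
  by have [l Hl] := weight_range a; exists l => xx w i; exact: (Hl _ _ _ (svalP xx)).
move=> /(_ range)[p [la [Hp Hla Hpp [c [c0 Hc]] Hjac]]].
have pE xx s : cyl_ratio (sval xx) s @ \oo --> p xx s.
  rewrite (_ : cyl_ratio (sval xx) s = nratio thX (fun yy : X => weight (sval yy))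
    (fun yy : X => z (sval yy)) xx (\1_(cylw s))); first exact: Hp.
  by apply/funext => n; rewrite /nratio !LnX iterX.
have laE xx : mass_ratio (sval xx) @ \oo --> la xx.
  have := Hla xx; rewrite (_ : (fun n => _) = mass_ratio (sval xx))//.
  by apply/funext => n; rewrite !LnX iterX.
have pE' xx s : cyl_mass (sval xx) s = p xx s by apply/cvg_lim => //; exact: pE.
have laE' xx : eigval (sval xx) = la xx by apply/cvg_lim => //; exact: laE.
split.
- by move=> x s Gx; have := pE (exist _ x Gx) s; rewrite -pE'.
- by move=> x Gx; have := laE (exist _ x Gx); rewrite -laE'.
- move=> x Gx; have [h1 h2 h3 h4] := Hpp (exist _ x Gx).
  split; first by rewrite -h1 -pE'.
  + by move=> s; rewrite (pE' (exist _ x Gx)).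
  + move=> s; rewrite (pE' (exist _ x Gx)); have := h3 s.
    rewrite (_ : (fun j => p _ (rcons s j)) = (fun j => cyl_mass x (rcons s j)))//.
    by apply/funext => j; rewrite -pE'.
  + by move=> s h; rewrite (pE' (exist _ x Gx)) h4.
- exists c; split=> // x Gx; rewrite (laE' (exist _ x Gx)); exact: Hc.
- move=> x e s w Gx s0 Ew sw; have := Hjac (exist _ x Gx) e s w s0 Ew sw.
  by rewrite -!pE' -laE'.
Qed.

(** * Measurability in the base point *)

Section Measurability.

Lemma measurable_comp_fun d1 d2 d3 (T1 : measurableType d1) (T2 : measurableType d2)
    (T3 : measurableType d3) (f : T2 -> T3) (g : T1 -> T2) : measurable_fun setT f ->
  measurable_fun setT g -> measurable_fun setT (fun x => f (g x)).
Proof. by move=> mf mg; exact: measurableT_comp. Qed.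

Lemma measurable_inv_fun d1 (T1 : measurableType d1) (f : T1 -> R) : (forall x, 0 <= f x) ->
  measurable_fun setT f -> measurable_fun setT (fun x => (f x)^-1).
Proof.
move=> f0 mf; rewrite (_ : (fun x => _) = (fun x => f x `^ (-1))).
  exact: (measurableT_comp (measurable_powR _) mf).
by apply/funext => x; rewrite powR_inv1.
Qed.

Hypothesis A_meas : A_measurable A.
Hypothesis phi_meas : measurable_fun (Omega theta A) (fun q : T * Seq => phi q.1 q.2).

Lemma Omega_meas : measurable (Omega theta A).
Proof.
rewrite (_ : Omega theta A = \bigcap_i \bigcup_a \bigcup_b
   ([set x | A (iter i theta x) a b] `*` ([set w : Seq | w i = a] `&` [set w : Seq | w i.+1 = b]))).
  apply: bigcapT_measurable => i; apply: bigcupT_measurable => a.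
  apply: bigcupT_measurable => b; apply: measurableX.
    exact: edge_meas.
  by apply: measurableI; exact: measurable_coord.
apply/seteqP; split=> -[x w] /=.
  by move=> Ew i _; exists (w i) => //; exists (w i.+1) => //; split=> //; exact: Ew.
by move=> h i; have [a _ [b _ [/= hA [wa wb]]]] := h i I; rewrite wa wb.
Qed.

Lemma scons_meas e : measurable_fun setT (scons e).
Proof.
apply: measurable_Seq => -[|n] k /=; last exact: measurable_coord.
by have [->|ek] := eqVneq e k;
  [rewrite (_ : [set x | _] = setT)//|rewrite (_ : [set x | _] = set0)//];
  apply/seteqP; split=> // x /= /eqP; rewrite (negbTE ek).
Qed.

Lemma weight_meas : measurable_fun setT (fun q : T * Seq => weight q.1 q.2).
Proof.
have mD : measurable weight_dom.
  apply: measurableI; first exact: Omega_meas.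
  by apply: measurableX => //; exact: good_set_meas.
have -> : (fun q : T * Seq => weight q.1 q.2) =
    (fun q => if q \in weight_dom then expR (phi q.1 q.2) else 0).
  by apply/funext => -[x w].
apply: measurable_fun_if => //.
- apply: (@measurable_fun_bool _ _ _ _ true); rewrite setTI.
  rewrite (_ : _ @^-1` _ = weight_dom)//; apply/seteqP; split=> q /=; first by move/set_mem.
  by move/mem_set.
- apply: (measurableT_comp (f := @expR R) (g := fun q : T * Seq => phi q.1 q.2)) => //.
  apply: measurable_funS phi_meas; first exact: Omega_meas.
  by move=> q [_ /= /set_mem[]].
Qed.

(** Joint measurability is needed because the iterate is evaluated at a base point that itself moves
    with x. *)
Lemma Ln_meas n g : bnd g -> measurable_fun setT g ->
  measurable_fun setT (fun q : T * Seq => TLn q.1 n g q.2).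
Proof.
move=> bg mg; elim: n => [|n IH].
  exact: (measurable_comp_fun mg measurable_snd).
pose h k (q : T * Seq) := series (fun e => weight (iter n theta q.1) (scons e q.2) *
  TLn q.1 n g (scons e q.2)) k.
apply: (@measurable_fun_cvg _ _ _ setT h).
  move=> k; rewrite /h /series/=; apply: measurable_sum => e.
  apply: measurable_funM.
    apply: (measurable_comp_fun (g := fun q : T * Seq => (iter n theta q.1, scons e q.2))
      weight_meas); apply: measurable_fun_pair.
      apply: (measurable_comp_fun (f := iter n theta) (g := fst)) => //.
      exact: iter_meas.
    exact: (measurable_comp_fun (scons_meas e) measurable_snd).
  apply: (measurable_comp_fun (g := fun q : T * Seq => (q.1, scons e q.2)) IH).
  apply: measurable_fun_pair; first exact: measurable_fst.
  exact: (measurable_comp_fun (scons_meas e) measurable_snd).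
move=> q _; apply: (L_cvg weight_ge0 weight_sum).
exact: (Ln_bnd theta weight_ge0 weight_sum weight_out).
Qed.

Lemma Ln_base_meas n k g : bnd g -> measurable_fun setT g ->
  measurable_fun setT (fun x => TLn x n g (z (iter k theta x))).
Proof.
move=> bg mg.
apply: (measurable_comp_fun (g := fun x : T => (x, z (iter k theta x))) (Ln_meas n bg mg)).
apply: measurable_fun_pair; first exact: measurable_id.
apply: (measurable_comp_fun (f := z) (g := iter k theta)); last exact: iter_meas.
exact: base_point_meas.
Qed.

Lemma cyl_mass_meas s : measurable_fun good_set (fun x => cyl_mass x s).
Proof.
have [Hp _ _ _ _] := limits.
apply: (@measurable_fun_cvg _ _ _ good_set (fun n x => cyl_ratio x s n)); last first.
  by move=> x Gx; exact: Hp.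
move=> n; apply: measurable_funTS; apply: measurable_funM.
  by apply: Ln_base_meas; [exact: bnd_ind|apply: measurable_indic; exact: measurable_cylw].
apply: measurable_inv_fun => [x|].
  apply: (Ln_ge0 weight_ge0 weight_sum weight_out); [exact: bnd_cst|by []|exact: base_point_in].
by apply: Ln_base_meas; [exact: bnd_cst|exact: measurable_cst].
Qed.

Lemma eigval_meas : measurable_fun good_set eigval.
Proof.
have [_ Hla _ _ _] := limits.
apply: (@measurable_fun_cvg _ _ _ good_set (fun n x => mass_ratio x n)) => //.
move=> n; apply: measurable_funTS; apply: measurable_funM.
  by apply: Ln_base_meas; [exact: bnd_cst|exact: measurable_cst].
apply: measurable_inv_fun => [x|].
  apply: (Ln_ge0 weight_ge0 weight_sum weight_out); [exact: bnd_cst|by []|].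
  by rewrite iterSr; exact: base_point_in.
have := measurable_comp_fun (Ln_base_meas n n (bnd_cst 1) (measurable_cst _)) theta_meas.
apply: eq_measurable_fun => x _ /=.
by rewrite -iterSr.
Qed.

Lemma Einf_meas x : measurable (Einf theta A x).
Proof.
have := measurable_xsection x Omega_meas.
rewrite (_ : xsection _ x = Einf theta A x)//.
by apply/seteqP; split=> w; rewrite /xsection/=; [move/set_mem|move=> h; exact/mem_set].
Qed.

(** Over bad points the Dirac mass at the selected sequence keeps nu_x carried by E_x^infty and
    measurable in x. *)
Lemma conformal_exists : exists nu : T -> probability Seq R,
  (forall x, good_set x -> forall s, nu x (cylw s) = (cyl_mass x s)%:E) /\
  (forall x, ~ good_set x -> forall B, nu x B = \d_(z x) B).
Proof.
have h x : exists P : probability Seq R,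
    (good_set x -> forall s, P (cylw s) = (cyl_mass x s)%:E) /\
    (~ good_set x -> forall B, P B = \d_(z x) B).
  have [Gx|nG] := pselect (good_set x); last by exists (dirac (z x)).
  have [_ _ /(_ x Gx)[h1 h2 h3 _] _ _] := limits.
  by have [P HP] := tree_measure h1 h2 h3; exists P.
have [nu Hnu] := choice h.
by exists nu; split=> x; case: (Hnu x).
Qed.

(** * Support, measurability and conformality of nu *)

Section Disintegration.
Variable nu : T -> probability Seq R.
Hypothesis nu_good : forall x, good_set x -> forall s, nu x (cylw s) = (cyl_mass x s)%:E.
Hypothesis nu_bad : forall x, ~ good_set x -> forall B, nu x B = \d_(z x) B.

(** A forbidden transition is visible on a finite prefix, so the complement is a countable union of
    cylinders missing E_x^infty, and each of these has mass 0. *)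
Lemma nu_Einf x : nu x (Einf theta A x) = 1%E.
Proof.
have [Gx|nG] := pselect (good_set x); last first.
  by rewrite nu_bad// diracE mem_set//; exact: base_point_in.
have [_ _ /(_ x Gx)[_ _ _ out] _ _] := limits.
rewrite -[Einf _ _ _]setCK probability_setC; last by apply: measurableC; exact: Einf_meas.
suff -> : nu x (~` Einf theta A x) = 0%E by rewrite sube0.
pose F k := if unpickle k is Some s then
  [set w | cylw s w /\ forall w, Einf theta A x w -> ~ cylw s w] else set0.
apply: measure_negligible; first by apply: measurableC; exact: Einf_meas.
apply: (@negligibleS _ _ _ _ (\bigcup_k F k)); last first.
  apply: negligible_bigcup => k; rewrite /F.
  case: (unpickle k) => [s|]; last exact: negligible_set0.
  have [os|nos] := pselect (forall w, Einf theta A x w -> ~ cylw s w).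
    apply: (@negligibleS _ _ _ _ (cylw s)); first by move=> w [].
    have ns : nu x (cylw s) = 0%E by rewrite nu_good// out.
    by exists (cylw s); split=> //; exact: measurable_cylw.
  rewrite (_ : [set w | _] = set0); first exact: negligible_set0.
  by apply/seteqP; split=> // w [_ /nos].
move=> w /= nE.
have /existsNP[i Ai] : ~ forall i, A (iter i theta x) (w i) (w i.+1) by [].
(* The prefix has length i + 2 so as to contain both letters i and i + 1 of the forbidden
   transition. *)
exists (pickle (mkseq w i.+2)) => //; rewrite /F pickleK; split=> [|v Ev].
  by move=> j; rewrite size_mkseq => ji; rewrite nth_mkseq.
move=> vw; apply: Ai; have := Ev i.
have -> : v i = w i by rewrite vw ?nth_mkseq ?size_mkseq.
by have -> : v i.+1 = w i.+1 by rewrite vw ?nth_mkseq ?size_mkseq.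
Qed.

Lemma nu_setI x B : measurable B -> nu x (B `&` Einf theta A x) = nu x B.
Proof.
move=> mB; have mE := Einf_meas x.
rewrite [RHS](measureDI (nu x) mB mE) [X in (X + _)%E](_ : _ = 0%E) ?add0e//.
apply/eqP; rewrite eq_le measure_ge0 andbT.
have <- : nu x (~` Einf theta A x) = 0%E by rewrite probability_setC// nu_Einf subee.
apply: le_measure; rewrite ?inE; [exact: measurableD|exact: measurableC|].
by move=> w [].
Qed.

Lemma nu_meas B : measurable B -> measurable_fun setT (fun x => nu x B).
Proof.
rewrite measurable_cyls; move: B.
apply: (dynkin_induction measurable_cyls cyls_setI).
- rewrite (_ : (fun x => _) = cst 1%E); first exact: measurable_cst.
  by apply/funext => x; rewrite probability_setT.
- move=> _ [->|[s ->]].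
    by rewrite (_ : (fun x => _) = cst 0%E)//; apply/funext => x; rewrite measure0.
  rewrite -(setUv good_set); apply/measurable_funU => //; [exact: good_set_meas|exact/measurableC/good_set_meas|split].
  + apply: (eq_measurable_fun (fun x => (cyl_mass x s)%:E)).
      by move=> x /set_mem Gx; rewrite nu_good.
    by apply/measurable_EFinP; exact: cyl_mass_meas.
  + apply: (eq_measurable_fun (fun x => (\1_(cylw s) (z x) : R)%:E)).
      by move=> x /set_mem nG; rewrite nu_bad// diracE indicE.
    apply: measurable_funTS; apply/measurable_EFinP.
    apply: (measurable_comp_fun (f := \1_(cylw s) : Seq -> R) (g := z)).
      by apply: measurable_indic; exact: measurable_cylw.
    exact: base_point_meas.
- move=> S mS mS'; rewrite (_ : (fun x => _) = (fun x => 1 - nu x S)%E).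
    exact: emeasurable_funB.
  by apply/funext => x; rewrite probability_setC.
- move=> F mF tF H; rewrite (_ : (fun x => _) = (fun x => \sum_(i <oo) nu x (F i))%E).
    by apply: ge0_emeasurable_sum => // k x _ _; exact: measure_ge0.
  apply/funext => x; rewrite measure_bigcup//=.
  by apply: eq_eseriesl => j; rewrite in_setT.
Qed.

(** The dual operator applied to the Dirac mass at w. *)
Definition preimages x (w : Seq) : {measure set Seq -> \bar R} :=
  mseries (fun e => mscale (NngNum (weight_ge0 x (scons e w))) (dirac (scons e w))) 0.

Lemma preimages_real x w B : preimages x w B = (TL x (\1_B) w)%:E.
Proof.
rewrite -nneseries_real; last exact: (L_cvg weight_ge0 weight_sum (bnd_ind R _)).
by apply: eq_eseriesr => e _; rewrite /mscale/= /dirac/= EFinM.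
Qed.

Lemma preimages_Lop x w B : good_set x -> Einf theta A (theta x) w ->
  preimages x w (B `&` Einf theta A x) = Lop A phi x (ind (B `&` Einf theta A x)) w.
Proof.
move=> Gx Ew; rewrite preimages_real (@Lop_real x w _ (\1_(B `&` Einf theta A x)))//.
exact: bnd_ind.
Qed.

Lemma weight_scons_meas x e : measurable_fun setT (fun w => weight x (scons e w)).
Proof.
apply: (measurable_comp_fun (f := fun q : T * Seq => weight q.1 q.2) (g := fun w => (x, scons e w))).
  exact: weight_meas.
apply: measurable_fun_pair; first exact: measurable_cst.
exact: scons_meas.
Qed.

Lemma preimages_meas x : kernel_meas_on (Einf theta A (theta x)) (preimages x).
Proof.
move=> B mB; apply: measurable_funTS.
apply: ge0_emeasurable_sum => [k w _ _|k _]; first exact: measure_ge0.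
apply/measurable_EFinP; apply: measurable_funM; first exact: weight_scons_meas.
apply: (measurable_comp_fun (f := \1_B : Seq -> R) (g := scons k)).
  exact: measurable_indic.
exact: scons_meas.
Qed.

(** The measure $\mathcal L_x^*\nu_{\theta(x)}$, as a superposition of the duals of Dirac masses. *)
Definition dual x : {measure set Seq -> \bar R} :=
  mixture (nu (theta x)) (Einf_meas (theta x)) (@preimages_meas x).

Lemma dual_cylw_cons x e s : dual x (cylw (e :: s)) =
  (\int[nu (theta x)]_(w in Einf theta A (theta x) `&` cylw s) (weight x (scons e w))%:E)%E.
Proof.
rewrite integral_mkcondr; apply: eq_integral => w _.
rewrite preimages_real L_cylw_cons patchE indicE.
by case: ifP => _; rewrite ?mulr1 ?mulr0.
Qed.

(** The mass of [es] is the integral over [s] of the weight of e prepended, which by [limits] stays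
    within the factor b of the constant p / q there. *)
Lemma dual_cylw_near x e s : good_set x -> s != [::] ->
  let b := expR (V * expR (- alpha) ^+ (size s).+1) in
  (dual x (cylw (e :: s)) <= b%:E * (eigval x * cyl_mass x (e :: s))%:E)%E /\
  ((eigval x * cyl_mass x (e :: s))%:E <= b%:E * dual x (cylw (e :: s)))%E.
Proof.
move=> Gx s0 b; have b0 : 0 < b by exact: expR_gt0.
have [_ _ pP [c [c0 Hc]] Hjac] := limits.
have [_ p0 _ pout] := pP x Gx; have [_ q0 _ _] := pP _ (good_set_theta Gx).
rewrite dual_cylw_cons; set C := _ `&` _.
have mC : measurable C by apply: measurableI; [exact: Einf_meas|exact: measurable_cylw].
have [[w0 [Ew0 sw0]]|C0] := pselect (exists w, C w); last first.
  (* If no admissible sequence over theta x starts with s, none over x starts with es, and both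
     sides vanish. *)
  have -> : C = set0 by apply/seteqP; split=> // w Cw; apply: C0; exists w.
  rewrite integral_set0 pout ?mulr0 ?mule0// => w Ew esw; apply: C0.
  exists (fun i => w i.+1); split=> [i|i si]; last exact: (esw i.+1).
  by rewrite -iterSr; exact: Ew.
set p := _ * cyl_mass _ _; pose q := cyl_mass (theta x) s.
have p_ge0 : 0 <= p.
  by rewrite mulr_ge0// (le_trans (ltW c0))//; have /andP[] := Hc x Gx.
have nuC : nu (theta x) C = q%:E.
  rewrite /C setIC nu_setI; last exact: measurable_cylw.
  by rewrite nu_good//; exact: good_set_theta.
have W0 w : C w -> (0 <= (weight x (scons e w))%:E)%E by rewrite lee_fin weight_ge0.
have mW : measurable_fun C (fun w => (weight x (scons e w))%:E).
  by apply/measurable_EFinP; apply: measurable_funTS; exact: weight_scons_meas.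
have cst_int (r : R) : (\int[nu (theta x)]_(w in C) r%:E)%E = (r * q)%:E.
  by rewrite EFinM -nuC; exact: integral_cst.
(* Division by q is impossible when [s] is null; then p = 0, and the integral vanishes because the
   weight is bounded on C by its value at w0 up to b. *)
have [q_0|q_n0] := eqVneq q 0.
  have pz : p = 0.
    apply/eqP; rewrite eq_le p_ge0 andbT.
    by have [] := Hjac x e s w0 Gx s0 Ew0 sw0; rewrite -/q q_0 !mulr0.
  rewrite pz mule0 mule_ge0 ?integral_ge0 ?lee_fin ?(ltW b0)//; split=> //.
  apply: (@le_trans _ _ (b * weight x (scons e w0) * q)%:E); last by rewrite q_0 mulr0.
  rewrite -cst_int; apply: ge0_le_integral => // w [Ew sw].
  rewrite lee_fin; apply: (@weight_dist x e (size s)) => //; first by rewrite lt0n size_eq0.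
  by move=> i si; rewrite sw// sw0.
have q_gt0 : 0 < q by rewrite lt_neqAle eq_sym q_n0 q0.
have bd w : C w -> p <= b * (weight x (scons e w) * q) /\ weight x (scons e w) * q <= b * p.
  by move=> [Ew sw]; exact: Hjac.
split.
  rewrite -EFinM -[b * p](divfK q_n0) -cst_int; apply: ge0_le_integral => // w Cw.
  by rewrite lee_fin ler_pdivlMr//; have [] := bd w Cw.
rewrite -lee_pdivrMl// -EFinM -[_ * p](divfK q_n0) -cst_int.
have r0 : 0 <= b^-1 * p / q.
  by apply: divr_ge0; [apply: mulr_ge0; rewrite ?invr_ge0 ?(ltW b0)|exact: ltW].
apply: ge0_le_integral => // w Cw; rewrite ?lee_fin//.
by rewrite ler_pdivrMr// ler_pdivrMl//; have [] := bd w Cw.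
Qed.

Lemma eigval_gt0 x : good_set x -> 0 < eigval x.
Proof.
move=> Gx; have [_ _ _ [c [c0 Hc]] _] := limits.
by apply: (lt_le_trans c0); have /andP[] := Hc x Gx.
Qed.

(** Cutting s into cylinders of length n gives both inequalities up to exp(V th^n); this factor
    tends to 1 while both sides stay fixed. *)
Lemma dual_cylw x s : good_set x -> dual x (cylw s) = (eigval x * cyl_mass x s)%:E.
Proof.
move=> Gx; have l0 := eigval_gt0 Gx.
pose m2 : {measure set Seq -> \bar R} := mscale (NngNum (ltW l0)) (nu x).
have m2E s' : m2 (cylw s') = (eigval x * cyl_mass x s')%:E.
  by rewrite /m2 /= /mscale/= nu_good.
pose b n := expR (V * expR (- alpha) ^+ n).
have step n : (1 < n)%N -> (size s <= n)%N ->
    (dual x (cylw s) <= (b n)%:E * m2 (cylw s))%E /\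
    (m2 (cylw s) <= (b n)%:E * dual x (cylw s))%E.
  move=> n1 sn; split; apply: (measure_cyl_le (n := n)) => //; rewrite ?expR_ge0//.
    move=> [|e [|a s']] sE; [by rewrite -sE in n1|by rewrite -sE in n1|].
    by rewrite m2E /b -sE; have [] := @dual_cylw_near x e (a :: s') Gx isT.
  move=> [|e [|a s']] sE; [by rewrite -sE in n1|by rewrite -sE in n1|].
  by rewrite m2E /b -sE; have [] := @dual_cylw_near x e (a :: s') Gx isT.
have b1 : b @ \oo --> (1 : R).
  have h : (fun n => V * expR (- alpha) ^+ n) @ \oo --> V * 0.
    by apply: cvgMr; apply: cvg_expr; rewrite ger0_norm ?expR_ge0// expR_lt1 oppr_lt0.
  by have := @cvg_comp _ _ _ (fun n : nat => V * expR (- alpha) ^+ n) expR _ _ _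
    h (@continuous_expR R (V * 0)); rewrite mulr0 expR0.
pose N := maxn 2 (size s).
have fin : dual x (cylw s) \is a fin_num.
  have [h _] := step N (leq_maxl _ _) (leq_maxr _ _).
  rewrite ge0_fin_numE ?measure_ge0//; apply: (le_lt_trans h).
  by rewrite m2E -EFinM ltry.
rewrite -m2E -(fineK fin) m2E; congr EFin; apply/eqP; rewrite eq_le; apply/andP; split.
  have h : (fun n => b n * (eigval x * cyl_mass x s)) @ \oo --> eigval x * cyl_mass x s.
    by rewrite -[X in _ --> X]mul1r; exact: cvgMr_tmp.
  apply: (ler_cvg_to (cvg_cst _) h); exists N => // n /= Nn.
  have [] := step n (leq_trans (leq_maxl _ _) Nn) (leq_trans (leq_maxr _ _) Nn).
  by rewrite -(fineK fin) m2E -EFinM lee_fin.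
have h : (fun n => b n * fine (dual x (cylw s))) @ \oo --> fine (dual x (cylw s)).
  by rewrite -[X in _ --> X]mul1r; exact: cvgMr_tmp.
apply: (ler_cvg_to (cvg_cst _) h); exists N => // n /= Nn.
have [_] := step n (leq_trans (leq_maxl _ _) Nn) (leq_trans (leq_maxr _ _) Nn).
by rewrite -[in leRHS](fineK fin) m2E -EFinM lee_fin.
Qed.

Lemma conformal x B : good_set x -> measurable B ->
  (\int[nu (theta x)]_(w in Einf theta A (theta x))
     Lop A phi x (ind (B `&` Einf theta A x)) w
   = (eigval x)%:E * nu x (B `&` Einf theta A x))%E.
Proof.
move=> Gx mB; have mBE := measurableI _ _ mB (Einf_meas x).
have l0 := eigval_gt0 Gx.
pose m2 : {measure set Seq -> \bar R} := mscale (NngNum (ltW l0)) (nu x).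
transitivity (dual x (B `&` Einf theta A x)).
  by apply: eq_integral => w /set_mem Ew; rewrite preimages_Lop.
have Hs s : dual x (cylw s) = m2 (cylw s) by rewrite dual_cylw// /m2 /= /mscale/= nu_good.
apply: (measure_cyl_eq (m2 := m2)) => //.
have -> : [set: Seq] = cylw [::] by apply/seteqP; split=> w // _ i.
by rewrite dual_cylw// ltry.
Qed.

End Disintegration.

Lemma conformal_measure_exists : exists (nu : T -> probability Seq R) (lam : T -> R),
  [/\ random_measure theta A nu, measurable_fun [set: T] lam, (forall x, 0 < lam x),
      (\forall x \ae m, forall B : set Seq, measurable B ->
        (\int[nu (theta x)]_(w in Einf theta A (theta x))
           Lop A phi x (ind (B `&` Einf theta A x)) w
         = (lam x)%:E * nu x (B `&` Einf theta A x))%E) &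
      (ess_sup m (fun x => (`|ln (lam x)|)%:E) < +oo)%E].
Proof.
have [nu [nuG nuB]] := conformal_exists.
(* The value 1 on the null set of bad points keeps [lam] positive and measurable. *)
pose lam x := if x \in good_set then eigval x else 1.
have lamG x : good_set x -> lam x = eigval x by move=> Gx; rewrite /lam mem_set.
exists nu, lam; split.
- by split; [exact: nu_Einf|exact: nu_meas].
- apply: measurable_fun_if => //.
  + apply: (@measurable_fun_bool _ _ _ _ true); rewrite setTI.
    rewrite (_ : _ @^-1` _ = good_set); first exact: good_set_meas.
    by apply/seteqP; split=> q /=; [move/set_mem|move/mem_set].
  + rewrite setTI (_ : _ @^-1` _ = good_set); first exact: eigval_meas.
    by apply/seteqP; split=> q /=; [move/set_mem|move/mem_set].
- by move=> x; rewrite /lam; case: ifP => // /set_mem; exact: eigval_gt0.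
- apply: filterS good_set_ae => x Gx B mB; rewrite lamG//; exact: conformal.
- have [_ _ _ [c [c0 Hc]] _] := limits.
  apply: (@le_lt_trans _ _ (Num.max `|ln c| `|ln weight_bound|)%:E); last exact: ltry.
  apply/ess_supP; apply: filterS good_set_ae => x Gx; rewrite lamG// lee_fin.
  have /andP[cl lM] := Hc x Gx; have l0 := eigval_gt0 Gx.
  rewrite le_max; have [l1|/ltW l1] := leP (eigval x) 1.
    rewrite ler0_norm ?ln_le0// [X in _ <= X]ler0_norm; last by rewrite ln_le0 ?(le_trans cl).
    by rewrite lerN2 ler_ln// cl.
  apply/orP; right; rewrite !ger0_norm ?ln_ge0 ?(le_trans l1)//.
  by rewrite ler_ln// posrE weight_bound_gt0.
Qed.

End Measurability.

End GoodSet.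

End Concrete.

Unset Implicit Arguments.
Set Strict Implicit.
Set Printing Implicit Defensive.

Theorem theorem1 (d : measure_display) (T : measurableType d) (R : realType)
  (m : probability T R) (theta : T -> T) (A : T -> nat -> nat -> bool)
  (phi : T -> Seq -> R) (alpha : R)
  (m_complete : measure_is_complete m)
  (theta_inv : invertible_measurable theta)
  (theta_pres : measure_preserving m theta)
  (A_meas : A_measurable A)
  (mixing : top_mixing theta A)
  (fin_range : finite_range m A)
  (bdd_access : bounded_access m A)
  (alpha_pos : 0 < alpha)
  (Hfine : fine_pair theta A phi m alpha) :
  exists (nu : T -> probability Seq R) (lam : T -> R),
    [/\ random_measure theta A nu,
        measurable_fun [set: T] lam,
        (forall x, 0 < lam x),
        (\forall x \ae m, forall B : set Seq, measurable B ->
            (\int[nu (theta x)]_(w in Einf theta A (theta x))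
               Lop A phi x (ind (B `&` Einf theta A x)) w
             = (lam x)%:E * nu x (B `&` Einf theta A x))%E) &
        (ess_sup m (fun x => (`|ln (lam x)|)%:E) < +oo)%E].
Proof.
have [thinv [_ _ theta_meas _]] := theta_inv.
have [V [cC [D [l_ [M0 [V0 cC0 M00 Hgood]]]]]] := good_exists Hfine fin_range.
have [[phi_meas _ _ _ _] _ _ _] := Hfine.
exact: (conformal_measure_exists m_complete theta_meas theta_pres Hgood cC0 V0 M00
  alpha_pos mixing A_meas phi_meas).
Qed.
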